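(* For all $z\in\mathbb{C}$ with $\operatorname{Re} z\ge0$, $$W(z)=\int_0^\infty\frac{1-e^{-z\xi}}{\xi}\,\varphi(\xi)\,d\xi ,$$ where $$\varphi(\xi)=\frac{1}{\pi}\int_0^\pi\exp\left(-\xi\, v\csc(v)\,e^{-v\cot v}\right)dv .$$
   Context: $W$ denotes the principal branch of the Lambert $W$ function: the unique holomorphic function on $\mathbb{C}\setminus(-\infty,-1/e]$ with $W(z)e^{W(z)}=z$ and $W(0)=0$. *)

(* Defs.v *)
From Stdlib Require Import Reals.
From Coquelicot Require Import Coquelicot.

Open Scope R_scope.

Definition csc (v : R) : R := / sin v.

Definition cot (v : R) : R := cos v / sin v.

Definition Cexp (z : C) : C :=
  (exp (fst z) * cos (snd z), exp (fst z) * sin (snd z)).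

Definition slit_plane (z : C) : Prop :=
  ~ (snd z = 0 /\ fst z <= - / exp 1).

Definition holomorphic_on (D : C -> Prop) (f : C -> C) : Prop :=
  forall z : C, D z -> ex_derive (K := C_AbsRing) (V := C_NormedModule) f z.

(* A function of type [C -> C] is total, so this determines [W] on
   [slit_plane] only; its values on the cut are unconstrained. *)
Definition is_principal_LambertW (W : C -> C) : Prop :=
  holomorphic_on slit_plane W /\
  (forall z : C, slit_plane z -> Cmult (W z) (Cexp (W z)) = z) /\
  W (RtoC 0) = RtoC 0.

(* For [0 < xi] the integrand is bounded on [0, PI] and continuous on its
   interior, so it is Riemann integrable.  At [v = 0] and [v = PI], where
   [sin v = 0], the library convention [/ 0 = 0] gives it the value 1, which
   does not affect the integral. *)
Definition phi (xi : R) : R :=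
  / PI * RInt (fun v : R => exp (- xi * (v * csc v * exp (- (v * cot v))))) 0 PI.

(* Absolutely convergent improper integral over (0, +oo).  The first conjunct
   excludes conditional convergence, so for a continuous [f] this is the same
   as being Lebesgue integrable with integral [l]. *)
Definition is_Cintegral_0_infty (f : R -> C) (l : C) : Prop :=
  ex_RInt_gen (fun t : R => Cmod (f t)) (at_right 0) (Rbar_locally p_infty) /\
  is_RInt_gen (V := C_R_NormedModule) f (at_right 0) (Rbar_locally p_infty) l.

(* Main.v *)
Require Import Defs.
From Stdlib Require Import Reals Lra.
From Coquelicot Require Import Coquelicot.

(** Write [g v = v csc v e^(- v cot v)] for [0 < v < PI]. Inserting the
    definition of [phi], exchanging the integrals and differentiating in [z]
    turns the claim into the Stieltjes formula

      [W' z = 1 / PI * int_0^PI dv / (z + g v)].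

    Put [w = W z], so that [z = w e^w] and [W' z = e^(-w) / (1 + w)]. The curve
    [zeta v = - v cot v + i v], [- PI < v < PI], satisfies
    [zeta e^zeta = - g v], so the formula is a residue computation for
    [1 / (w e^w - u e^u)], whose only pole to the right of the curve is [u = w].
    Instead of a residue theorem the proof uses

      [((1 + w) e^w - (1 + u) e^u) / (w e^w - u e^u) = 1 + regularized w u],

    which has no pole at all there. On the curve the term [(1 + u) e^u du] is
    real and odd in [v], so it drops out, and [du] contributes only [i dv]; hence
    the integral of [regularized w] along the part [|v| <= a] of the curve is
    [2 i] times [(1 + w) e^w int_0^a dv / (z + g v) - a]
    ([regularized_contour_even]). By Cauchy's theorem ([cauchy_goursat]) the
    same integral may be taken over the vertical segment joining the end points,
    where [regularized w] is small, and it tends to [0] as [a] tends to [PI]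
    ([resolvent_integral]).

    Holomorphy of [regularized w] needs [u e^u <> w e^w] for the other points
    [u] to the right of the curve ([expdiff_denom_neq_0]), and this uses where
    [W] maps the closed right half-plane ([principal_right_branch]).

    The passage from the derivative to [W] itself is made for the integral over
    a segment [[al, be]]. Along the ray [t z] it and [W (t z)] vanish at [t = 0],
    and by the exact Laplace transform over the segment ([laplace_phi_segment])
    their derivatives differ by at most [|z| (al + e e^(- be / e))]; the mean
    value inequality gives [truncated_error], from which the improper integral
    follows by [al -> 0], [be -> +oo]. *)

(** * Complex-valued functions of a real variable *)

Notation Cderive := (is_derive (K := C_AbsRing) (V := C_NormedModule)).
Notation Rderive := (is_derive (K := R_AbsRing) (V := C_R_NormedModule)).
Notation is_CInt := (is_RInt (V := C_R_NormedModule)).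
Notation ex_CInt := (ex_RInt (V := C_R_NormedModule)).

Lemma norm_Cmod (x : C) : @norm R_AbsRing C_R_NormedModule x = Cmod x.
Proof. symmetry; apply Cmod_norm. Qed.

Lemma Cmod_le_comp (x : C) : Cmod x <= Rabs (fst x) + Rabs (snd x).
Proof.
  unfold Cmod. apply Rsqr_incr_0_var.
  - rewrite Rsqr_sqrt by nra.
    assert (H1 := Rabs_pos (fst x)). assert (H2 := Rabs_pos (snd x)).
    unfold Rsqr. rewrite <- (pow2_abs (fst x)), <- (pow2_abs (snd x)). nra.
  - assert (H1 := Rabs_pos (fst x)). assert (H2 := Rabs_pos (snd x)). lra.
Qed.

Lemma fst_le_Cmod (x : C) : Rabs (fst x) <= Cmod x.
Proof. eapply Rle_trans; [apply Rmax_l | apply Rmax_Cmod]. Qed.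

Lemma snd_le_Cmod (x : C) : Rabs (snd x) <= Cmod x.
Proof. eapply Rle_trans; [apply Rmax_r | apply Rmax_Cmod]. Qed.

Lemma locally_Cmod (p : C) (P : C -> Prop) :
  locally p P <-> exists eta, 0 < eta /\ forall u, Cmod (u - p) < eta -> P u.
Proof.
  split.
  - intros [e He]. exists e; split; [apply cond_pos|]. intros u Hu.
    apply He. apply C_NormedModule_mixin_compat1. exact Hu.
  - intros [e [He H]].
    assert (H2 : 0 < e / sqrt 2).
    { apply Rdiv_lt_0_compat; [exact He | apply sqrt_lt_R0; lra]. }
    exists (mkposreal _ H2). intros u Hu. apply H.
    assert (K := C_NormedModule_mixin_compat2 p u _ Hu). simpl in K.
    replace (sqrt 2 * (e / sqrt 2)) with e in K; [exact K|].
    field. assert (0 < sqrt 2) by (apply sqrt_lt_R0; lra). lra.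
Qed.

Lemma Cderive_eps (f : C -> C) (p l : C) :
  Cderive f p l <->
  forall eps, 0 < eps -> exists eta, 0 < eta /\ forall u, Cmod (u - p) < eta ->
    Cmod (f u - f p - l * (u - p)) <= eps * Cmod (u - p).
Proof.
  split.
  - intros [_ H] eps He.
    specialize (H p (fun P HP => HP) (mkposreal _ He)).
    destruct H as [eta H].
    exists eta; split; [apply cond_pos|]. intros u Hu. specialize (H u Hu).
    change (Cmod ((f u - f p) - (u - p) * l) <= eps * Cmod (u - p)) in H.
    rewrite (Cmult_comm l). exact H.
  - intros H. split.
    + apply (is_linear_scal_l (K := C_AbsRing)).
    + intros x Hx. apply (is_filter_lim_locally_unique (K := C_AbsRing)
        (V := AbsRing_NormedModule C_AbsRing)) in Hx. rewrite <- Hx.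
      intros eps. destruct (H eps (cond_pos eps)) as [eta [Heta K]].
      exists (mkposreal _ Heta). intros u Hu.
      change (Cmod ((f u - f p) - (u - p) * l) <= eps * Cmod (u - p)).
      rewrite (Cmult_comm _ l). apply K, Hu.
Qed.

Lemma Rderive_eps (f : R -> C) (t : R) (l : C) :
  Rderive f t l <->
  forall eps, 0 < eps -> exists eta, 0 < eta /\ forall s, Rabs (s - t) < eta ->
    Cmod (f s - f t - RtoC (s - t) * l) <= eps * Rabs (s - t).
Proof.
  assert (E : forall s, minus (minus (f s) (f t)) (scal (minus s t) l)
     = (f s - f t - RtoC (s - t) * l)%C).
  { intros s. apply injective_projections; unfold minus, plus, opp, scal; simpl;
    unfold prod_scal, scal; simpl; unfold mult, plus, opp; simpl; ring. }
  split.
  - intros [_ H] eps He.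
    specialize (H t (fun P HP => HP) (mkposreal _ He)).
    destruct H as [eta H]. exists eta; split; [apply cond_pos|].
    intros s Hs. specialize (H s Hs). rewrite <- E. rewrite <- norm_Cmod. exact H.
  - intros H. split.
    + apply (is_linear_scal_l (K := R_AbsRing) (V := C_R_NormedModule)).
    + intros x Hx. apply (is_filter_lim_locally_unique (K := R_AbsRing)
        (V := AbsRing_NormedModule R_AbsRing)) in Hx. rewrite <- Hx.
      intros eps. destruct (H eps (cond_pos eps)) as [eta [Heta K]].
      exists (mkposreal _ Heta). intros s Hs.
      change (Rabs (s - t) < eta) in Hs. specialize (K s Hs).
      rewrite <- E, <- norm_Cmod in K. exact K.
Qed.

(** The common core of the chain rules for inner functions of a complex and of a
    real variable: the inner function enters only through the value [q] that it
    takes after an increment [h]. *)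
Lemma chain_estimate (f : C -> C) (p l d : C) (eps : R) :
  Cderive f p l -> 0 < eps ->
  exists e1 e2, 0 < e1 /\ 0 < e2 /\ forall q h : C,
    Cmod h < e1 -> Cmod (q - p - d * h) <= e2 * Cmod h ->
    Cmod (f q - f p - (l * d) * h) <= eps * Cmod h.
Proof.
  intros Hf He. rewrite Cderive_eps in Hf.
  assert (Hd := Cmod_ge_0 d). assert (Hl := Cmod_ge_0 l).
  destruct (Hf (eps / 2 / (Cmod d + 1))) as [e1 [He1 H1]].
  { apply Rdiv_lt_0_compat; lra. }
  assert (P1 : 0 < e1 / (Cmod d + 1)) by (apply Rdiv_lt_0_compat; lra).
  assert (P2 : 0 < eps / 2 / (Cmod l + 1)) by (apply Rdiv_lt_0_compat; lra).
  exists (e1 / (Cmod d + 1)), (Rmin 1 (eps / 2 / (Cmod l + 1))).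
  split; [exact P1|]. split; [apply Rmin_glb_lt; [lra|exact P2]|].
  intros q h Hh H2. assert (Hh0 := Cmod_ge_0 h).
  set (r := (q - p - d * h)%C) in *.
  assert (Hr1 : Cmod r <= 1 * Cmod h).
  { eapply Rle_trans; [exact H2|]. apply Rmult_le_compat_r; [exact Hh0|apply Rmin_l]. }
  assert (Hr2 : Cmod r <= eps / 2 / (Cmod l + 1) * Cmod h).
  { eapply Rle_trans; [exact H2|]. apply Rmult_le_compat_r; [exact Hh0|apply Rmin_r]. }
  assert (Eg : (q - p = d * h + r)%C) by (unfold r; ring).
  assert (Hgd : Cmod (q - p) <= (Cmod d + 1) * Cmod h).
  { rewrite Eg. eapply Rle_trans; [apply Cmod_triangle|]. rewrite Cmod_mult. lra. }
  assert (Hlt : Cmod (q - p) < e1).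
  { eapply Rle_lt_trans; [exact Hgd|].
    apply (Rmult_lt_compat_l (Cmod d + 1)) in Hh; [|lra].
    replace ((Cmod d + 1) * (e1 / (Cmod d + 1))) with e1 in Hh by (field; lra).
    exact Hh. }
  specialize (H1 _ Hlt).
  replace (f q - f p - l * d * h)%C
    with ((f q - f p - l * (q - p)) + l * r)%C by (rewrite Eg; ring).
  eapply Rle_trans; [apply Cmod_triangle|]. rewrite Cmod_mult.
  assert (K1 : eps / 2 / (Cmod d + 1) * Cmod (q - p) <= eps / 2 * Cmod h).
  { replace (eps / 2 * Cmod h)
      with (eps / 2 / (Cmod d + 1) * ((Cmod d + 1) * Cmod h)) by (field; lra).
    apply Rmult_le_compat_l; [|exact Hgd].
    apply Rlt_le, Rdiv_lt_0_compat; lra. }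
  assert (K2 : Cmod l * Cmod r <= eps / 2 * Cmod h).
  { replace (eps / 2 * Cmod h)
      with ((Cmod l + 1) * (eps / 2 / (Cmod l + 1) * Cmod h)) by (field; lra).
    apply Rmult_le_compat; try lra; apply Cmod_ge_0. }
  lra.
Qed.

Lemma Cderive_comp (f g : C -> C) (p l d : C) :
  Cderive f (g p) l -> Cderive g p d -> Cderive (fun u => f (g u)) p (l * d)%C.
Proof.
  intros Hf Hg. apply Cderive_eps. intros eps He. rewrite Cderive_eps in Hg.
  destruct (chain_estimate f (g p) l d eps Hf He) as [e1 [e2 [He1 [He2 H]]]].
  destruct (Hg e2 He2) as [e3 [He3 K]].
  exists (Rmin e1 e3). split; [apply Rmin_glb_lt; assumption|]. intros u Hu. apply H.
  - exact (Rlt_le_trans _ _ _ Hu (Rmin_l _ _)).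
  - apply K. exact (Rlt_le_trans _ _ _ Hu (Rmin_r _ _)).
Qed.

Lemma Rderive_comp (f : C -> C) (g : R -> C) (t : R) (l d : C) :
  Cderive f (g t) l -> Rderive g t d -> Rderive (fun s => f (g s)) t (l * d)%C.
Proof.
  intros Hf Hg. apply Rderive_eps. intros eps He. rewrite Rderive_eps in Hg.
  destruct (chain_estimate f (g t) l d eps Hf He) as [e1 [e2 [He1 [He2 H]]]].
  destruct (Hg e2 He2) as [e3 [He3 K]].
  exists (Rmin e1 e3). split; [apply Rmin_glb_lt; assumption|]. intros s Hs.
  rewrite (Cmult_comm _ (l * d)%C), <- Cmod_R. apply H.
  - rewrite Cmod_R. exact (Rlt_le_trans _ _ _ Hs (Rmin_l _ _)).
  - rewrite (Cmult_comm d), Cmod_R. apply K. exact (Rlt_le_trans _ _ _ Hs (Rmin_r _ _)).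
Qed.

Lemma Rderive_pair (f : R -> C) (t : R) (d : C) :
  is_derive (fun s => fst (f s)) t (fst d) ->
  is_derive (fun s => snd (f s)) t (snd d) -> Rderive f t d.
Proof.
  intros H1 H2. apply Rderive_eps. intros eps He.
  apply is_derive_Reals in H1. apply is_derive_Reals in H2.
  assert (He2 : 0 < eps / 2) by lra.
  destruct (H1 _ He2) as [e1 K1]. destruct (H2 _ He2) as [e2 K2].
  exists (Rmin e1 e2). split; [apply Rmin_glb_lt; apply cond_pos|].
  intros s Hs. destruct (Req_dec s t) as [->|Hst].
  { replace (f t - f t - RtoC (t - t) * d)%C with (RtoC 0).
    - rewrite Cmod_0. apply Rmult_le_pos; [lra|apply Rabs_pos].
    - rewrite Rminus_diag. ring. }
  assert (Hh : s - t <> 0) by lra.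
  specialize (K1 _ Hh (Rlt_le_trans _ _ _ Hs (Rmin_l _ _))).
  specialize (K2 _ Hh (Rlt_le_trans _ _ _ Hs (Rmin_r _ _))).
  replace (t + (s - t)) with s in K1, K2 by ring.
  eapply Rle_trans; [apply Cmod_le_comp|]. simpl.
  assert (Aux : forall a b d0, Rabs ((a - b) / (s - t) - d0) < eps / 2 ->
     Rabs (a - b - (s - t) * d0) <= eps / 2 * Rabs (s - t)).
  { intros a b d0 H.
    replace (a - b - (s - t) * d0) with (((a - b) / (s - t) - d0) * (s - t))
      by (field; exact Hh).
    rewrite Rabs_mult. apply Rmult_le_compat_r; [apply Rabs_pos|lra]. }
  apply Aux in K1. apply Aux in K2.
  replace (fst (f s) + - fst (f t) + - ((s - t) * fst d - 0 * snd d))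
    with (fst (f s) - fst (f t) - (s - t) * fst d) by ring.
  replace (snd (f s) + - snd (f t) + - ((s - t) * snd d + 0 * fst d))
    with (snd (f s) - snd (f t) - (s - t) * snd d) by ring.
  lra.
Qed.

Lemma Rderive_fst_snd (f : R -> C) (t : R) (d : C) :
  Rderive f t d ->
  is_derive (fun s => fst (f s)) t (fst d) /\ is_derive (fun s => snd (f s)) t (snd d).
Proof.
  intros H. rewrite Rderive_eps in H.
  assert (Aux : forall p : C -> R,
    (forall x, Rabs (p x) <= Cmod x) ->
    (forall s, p (f s - f t - RtoC (s - t) * d)%C = p (f s) - p (f t) - (s - t) * p d) ->
    is_derive (fun s => p (f s)) t (p d)).
  { intros p Hp Hlin. apply is_derive_Reals. intros eps He.
    destruct (H (eps / 2)) as [e [He0 K]]; [lra|].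
    exists (mkposreal _ He0). intros h Hh Hlt. simpl in Hlt.
    specialize (K (t + h)). replace (t + h - t) with h in K by ring.
    specialize (K Hlt).
    specialize (Hp (f (t + h)%R - f t - RtoC h * d)%C).
    specialize (Hlin (t + h)). replace (t + h - t) with h in Hlin by ring.
    rewrite Hlin in Hp.
    replace ((p (f (t + h)) - p (f t)) / h - p d)
      with ((p (f (t + h)) - p (f t) - h * p d) / h) by (field; exact Hh).
    unfold Rdiv. rewrite Rabs_mult, Rabs_inv.
    assert (Hpos : 0 < Rabs h) by (apply Rabs_pos_lt, Hh).
    apply (Rmult_lt_reg_r (Rabs h)); [exact Hpos|].
    rewrite Rmult_assoc, Rinv_l, Rmult_1_r by lra. nra. }
  split; apply Aux; try apply fst_le_Cmod; try apply snd_le_Cmod;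
    intros s; simpl; ring.
Qed.


Lemma continuous_pair (f : R -> C) (t : R) :
  continuous (fun s => fst (f s)) t -> continuous (fun s => snd (f s)) t ->
  continuous f t.
Proof.
  intros H1 H2. apply filterlim_locally. intros eps.
  apply filterlim_locally with (eps := eps) in H1.
  apply filterlim_locally with (eps := eps) in H2.
  generalize (filter_and _ _ H1 H2). apply filter_imp. intros s K. exact K.
Qed.

Lemma continuous_re (f : R -> C) (t : R) :
  continuous f t -> continuous (fun s => fst (f s)) t.
Proof. intros H. apply (continuous_comp f fst); [exact H | apply continuous_fst]. Qed.

Lemma continuous_im (f : R -> C) (t : R) :
  continuous f t -> continuous (fun s => snd (f s)) t.
Proof. intros H. apply (continuous_comp f snd); [exact H | apply continuous_snd]. Qed.

Lemma continuous_Rplus (f g : R -> R) (t : R) :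
  continuous f t -> continuous g t -> continuous (fun s => f s + g s) t.
Proof. apply (continuous_plus (V := R_NormedModule)). Qed.

Lemma continuous_Rminus (f g : R -> R) (t : R) :
  continuous f t -> continuous g t -> continuous (fun s => f s - g s) t.
Proof. apply (continuous_minus (V := R_NormedModule)). Qed.

Lemma continuous_Rmult (f g : R -> R) (t : R) :
  continuous f t -> continuous g t -> continuous (fun s => f s * g s) t.
Proof. apply (continuous_mult (K := R_AbsRing)). Qed.

Lemma continuous_RtoC (f : R -> R) (t : R) :
  continuous f t -> continuous (fun s => RtoC (f s)) t.
Proof. intros H. apply continuous_pair; [exact H | apply continuous_const]. Qed.

Lemma continuous_Cmult (f g : R -> C) (t : R) :
  continuous f t -> continuous g t -> continuous (fun s => f s * g s)%C t.
Proof.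
  intros Hf Hg.
  assert (F1 := continuous_re f t Hf). assert (F2 := continuous_im f t Hf).
  assert (G1 := continuous_re g t Hg). assert (G2 := continuous_im g t Hg).
  apply continuous_pair.
  - exact (continuous_Rminus _ _ t (continuous_Rmult _ _ t F1 G1)
             (continuous_Rmult _ _ t F2 G2)).
  - exact (continuous_Rplus _ _ t (continuous_Rmult _ _ t F1 G2)
             (continuous_Rmult _ _ t F2 G1)).
Qed.

Lemma continuous_Cplus (f g : R -> C) (t : R) :
  continuous f t -> continuous g t -> continuous (fun s => f s + g s)%C t.
Proof. apply (continuous_plus (V := C_R_NormedModule)). Qed.

Lemma continuous_Cminus (f g : R -> C) (t : R) :
  continuous f t -> continuous g t -> continuous (fun s => f s - g s)%C t.
Proof. apply (continuous_minus (V := C_R_NormedModule)). Qed.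

Lemma Cmod_sqr (x : C) : Cmod x * Cmod x = fst x * fst x + snd x * snd x.
Proof. unfold Cmod. rewrite sqrt_sqrt by nra. ring. Qed.

Lemma dot_le_Cmod (x y : C) : fst x * fst y + snd x * snd y <= Cmod x * Cmod y.
Proof.
  assert (Hx := Cmod_ge_0 x). assert (Hy := Cmod_ge_0 y).
  assert (Sx := Cmod_sqr x). assert (Sy := Cmod_sqr y).
  destruct x as [a b], y as [c d]; simpl in *.
  apply Rsqr_incr_0_var; [|nra]. unfold Rsqr.
  replace (Cmod (a, b) * Cmod (c, d) * (Cmod (a, b) * Cmod (c, d)))
    with ((a * a + b * b) * (c * c + d * d)) by (rewrite <- Sx, <- Sy; ring).
  assert (0 <= (a * d - b * c) * (a * d - b * c)) by apply Rle_0_sqr. nra.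
Qed.

(** Projecting on the direction of [f b - f a] reduces this to the scalar mean
    value theorem without losing a constant. *)
Lemma mean_value_ineq (f df : R -> C) (a b M : R) :
  a <= b ->
  (forall t, a < t < b -> Rderive f t (df t)) ->
  (forall t, a <= t <= b -> continuous f t) ->
  (forall t, a < t < b -> Cmod (df t) <= M) ->
  Cmod (f b - f a) <= M * (b - a).
Proof.
  intros Hab Hd Hc HM.
  destruct (Req_dec a b) as [->|Hne].
  { replace (f b - f b)%C with (RtoC 0) by ring. rewrite Cmod_0, Rminus_diag. lra. }
  assert (HM0 : 0 <= M).
  { eapply Rle_trans; [apply Cmod_ge_0 | apply (HM ((a + b) / 2)); lra]. }
  set (D := (f b - f a)%C).
  set (dg := fun t => if Rlt_dec a t then if Rlt_dec t b then
      fst (df t) * fst D + snd (df t) * snd D else 0 else 0).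
  destruct (MVT_gen (fun t => fst (f t) * fst D + snd (f t) * snd D) a b dg)
    as [c [_ Hc2]].
  - rewrite Rmin_left, Rmax_right by lra. intros t Ht. unfold dg.
    destruct (Rlt_dec a t) as [_|]; [|lra]. destruct (Rlt_dec t b) as [_|]; [|lra].
    destruct (Rderive_fst_snd _ _ _ (Hd t Ht)) as [H1 H2].
    apply (is_derive_plus (K := R_AbsRing) (V := R_NormedModule)).
    + exact (is_derive_scal_l (K := R_AbsRing) (V := R_NormedModule) _ t _ (fst D) H1).
    + exact (is_derive_scal_l (K := R_AbsRing) (V := R_NormedModule) _ t _ (snd D) H2).
  - rewrite Rmin_left, Rmax_right by lra. intros t Ht.
    assert (K := Hc t Ht).
    apply continuity_pt_filterlim.
    change (continuous (fun t => fst (f t) * fst D + snd (f t) * snd D) t).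
    apply continuous_Rplus; apply continuous_Rmult.
    + apply continuous_re, K.
    + apply continuous_const.
    + apply continuous_im, K.
    + apply continuous_const.
  - assert (E : Cmod D * Cmod D = dg c * (b - a)).
    { rewrite <- Hc2, Cmod_sqr. unfold D. simpl. ring. }
    assert (Hdg : dg c <= M * Cmod D).
    { assert (HD := Cmod_ge_0 D). unfold dg.
      destruct (Rlt_dec a c); [|nra]. destruct (Rlt_dec c b); [|nra].
      eapply Rle_trans; [apply dot_le_Cmod|].
      apply Rmult_le_compat_r; [exact HD|apply HM; lra]. }
    destruct (Cmod_ge_0 D) as [HD|HD]; [|rewrite <- HD; nra].
    apply (Rmult_le_reg_l (Cmod D)); [exact HD|].
    rewrite E. replace (Cmod D * (M * (b - a))) with (M * Cmod D * (b - a)) by ring.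
    apply Rmult_le_compat_r; lra.
Qed.

Lemma continuous_Cmod (p : C) : continuous Cmod p.
Proof.
  apply filterlim_locally. intros eps. apply locally_Cmod.
  exists eps; split; [apply cond_pos|]. intros u Hu.
  change (Rabs (Cmod u - Cmod p) < eps).
  assert (T1 := Cmod_triangle (u - p) p). assert (T2 := Cmod_triangle (- (u - p)) u).
  rewrite Cmod_opp in T2. replace (u - p + p)%C with u in T1 by ring.
  replace (- (u - p) + u)%C with p in T2 by ring.
  apply Rabs_def1; lra.
Qed.

Lemma Rderive_continuous (f : R -> C) (t : R) (d : C) : Rderive f t d -> continuous f t.
Proof.
  intros H. apply (ex_derive_continuous (K := R_AbsRing) (V := C_R_NormedModule)).
  exists d; exact H.
Qed.

Lemma Cderive_continuous (f : C -> C) (p d : C) : Cderive f p d -> continuous f p.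
Proof.
  intros H. rewrite Cderive_eps in H.
  destruct (H 1) as [e [He K]]; [lra|].
  apply filterlim_locally. intros eps.
  apply locally_Cmod. assert (Hd := Cmod_ge_0 d).
  exists (Rmin e (eps / (Cmod d + 1))). split.
  { apply Rmin_glb_lt; [exact He|]. apply Rdiv_lt_0_compat; [apply cond_pos|lra]. }
  intros u Hu.
  specialize (K u (Rlt_le_trans _ _ _ Hu (Rmin_l _ _))).
  apply (C_NormedModule_mixin_compat1 (f p) (f u)).
  change (Cmod (f u - f p) < eps).
  replace (f u - f p)%C with ((f u - f p - d * (u - p)) + d * (u - p))%C by ring.
  eapply Rle_lt_trans; [apply Cmod_triangle|]. rewrite Cmod_mult.
  assert (L := Rlt_le_trans _ _ _ Hu (Rmin_r _ _)).
  apply (Rmult_lt_compat_l (Cmod d + 1)) in L; [|lra].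
  replace ((Cmod d + 1) * (eps / (Cmod d + 1))) with (pos eps) in L by (field; lra).
  lra.
Qed.

(** * Complex differentiation *)

Lemma Cderive_const (c p : C) : Cderive (fun _ => c) p (RtoC 0).
Proof.
  apply Cderive_eps. intros eps He. exists 1; split; [lra|]. intros u _.
  replace (c - c - 0 * (u - p))%C with (RtoC 0) by ring. rewrite Cmod_0.
  assert (H := Cmod_ge_0 (u - p)). nra.
Qed.

Lemma Cderive_id (p : C) : Cderive (fun u => u) p (RtoC 1).
Proof.
  apply Cderive_eps. intros eps He. exists 1; split; [lra|]. intros u _.
  replace (u - p - 1 * (u - p))%C with (RtoC 0) by ring. rewrite Cmod_0.
  assert (H := Cmod_ge_0 (u - p)). nra.
Qed.

Lemma Cderive_eq (f : C -> C) (p d d' : C) : Cderive f p d -> d = d' -> Cderive f p d'.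
Proof. intros H <-; exact H. Qed.

Lemma Cderive_plus (f g : C -> C) (p a b : C) :
  Cderive f p a -> Cderive g p b -> Cderive (fun u => f u + g u)%C p (a + b)%C.
Proof.
  rewrite !Cderive_eps. intros Hf Hg eps He.
  destruct (Hf (eps / 2)) as [e1 [He1 K1]]; [lra|].
  destruct (Hg (eps / 2)) as [e2 [He2 K2]]; [lra|].
  exists (Rmin e1 e2). split; [apply Rmin_glb_lt; assumption|]. intros u Hu.
  specialize (K1 u (Rlt_le_trans _ _ _ Hu (Rmin_l _ _))).
  specialize (K2 u (Rlt_le_trans _ _ _ Hu (Rmin_r _ _))).
  replace (f u + g u - (f p + g p) - (a + b) * (u - p))%C
    with ((f u - f p - a * (u - p)) + (g u - g p - b * (u - p)))%C by ring.
  eapply Rle_trans; [apply Cmod_triangle|]. lra.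
Qed.

(** A derivative from a quadratic remainder estimate, the form in which the
    explicit functions below are differentiated. *)
Lemma Cderive_quadratic (f : C -> C) (p l : C) (e K : R) :
  0 < e ->
  (forall u, Cmod (u - p) < e -> Cmod (f u - f p - l * (u - p)) <= K * Cmod (u - p) ^ 2) ->
  Cderive f p l.
Proof.
  intros He H. apply Cderive_eps. intros eps Heps.
  assert (HK := Rabs_pos K).
  exists (Rmin e (eps / (Rabs K + 1))). split.
  { apply Rmin_glb_lt; [exact He|apply Rdiv_lt_0_compat; lra]. }
  intros u Hu.
  specialize (H u (Rlt_le_trans _ _ _ Hu (Rmin_l _ _))).
  assert (L := Rlt_le_trans _ _ _ Hu (Rmin_r _ _)).
  apply (Rmult_lt_compat_l (Rabs K + 1)) in L; [|lra].
  replace ((Rabs K + 1) * (eps / (Rabs K + 1))) with eps in L by (field; lra).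
  eapply Rle_trans; [exact H|].
  assert (Hc := Cmod_ge_0 (u - p)). assert (HK2 := Rle_abs K). nra.
Qed.

(** These two normed modules have the same norm but are not convertible, and the
    product rule for functions into a ring speaks of the second one. *)
Lemma Cderive_AbsRing (f : C -> C) (p l : C) :
  Cderive f p l <->
  is_derive (K := C_AbsRing) (V := AbsRing_NormedModule C_AbsRing) f p l.
Proof.
  split; intros [_ H]; split; try exact H;
    apply (is_linear_scal_l (K := C_AbsRing)).
Qed.

Lemma Cderive_mult (f g : C -> C) (p a b : C) :
  Cderive f p a -> Cderive g p b -> Cderive (fun u => f u * g u)%C p (a * g p + f p * b)%C.
Proof.
  rewrite !Cderive_AbsRing. intros Hf Hg.
  exact (is_derive_mult (K := C_AbsRing) f g p a b Hf Hg Cmult_comm).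
Qed.

Lemma Cderive_inv (p : C) : p <> 0 -> Cderive (fun u => / u)%C p (- / (p * p))%C.
Proof.
  intros Hp. assert (HP : 0 < Cmod p) by (apply Cmod_gt_0, Hp).
  apply (Cderive_quadratic _ _ _ (Cmod p / 2) (2 / Cmod p ^ 3)); [lra|].
  intros u Hu.
  assert (Hu1 : Cmod p / 2 <= Cmod u).
  { assert (H := Cmod_triangle u (p - u)). replace (u + (p - u))%C with p in H by ring.
    replace (p - u)%C with (- (u - p))%C in H by ring. rewrite Cmod_opp in H. lra. }
  assert (Hu0 : u <> 0) by (apply Cmod_gt_0; lra).
  replace (/ u - / p - - / (p * p) * (u - p))%C
    with ((u - p) * (u - p) / (p * p * u))%C.
  2:{ field; split; assumption. }
  rewrite Cmod_div, !Cmod_mult.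
  2:{ apply Cmod_gt_0. rewrite !Cmod_mult. repeat apply Rmult_lt_0_compat; lra. }
  assert (HU := Cmod_ge_0 (u - p)).
  replace (2 / Cmod p ^ 3 * Cmod (u - p) ^ 2)
    with (Cmod (u - p) * Cmod (u - p) * / (Cmod p * Cmod p * (Cmod p / 2)))
    by (field; lra).
  apply Rmult_le_compat_l; [nra|]. apply Rinv_le_contravar.
  - repeat apply Rmult_lt_0_compat; lra.
  - apply Rmult_le_compat_l; [nra|exact Hu1].
Qed.

(** * The complex exponential *)

Lemma Cexp_plus (x y : C) : Cexp (x + y) = (Cexp x * Cexp y)%C.
Proof.
  destruct x as [a b], y as [c d]. unfold Cexp; simpl. rewrite exp_plus, cos_plus, sin_plus.
  apply injective_projections; simpl; ring.
Qed.

Lemma Cexp_0 : Cexp 0 = 1.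
Proof.
  unfold Cexp; simpl. rewrite exp_0, cos_0, sin_0.
  apply injective_projections; simpl; ring.
Qed.

Lemma Cmod_Cexp (x : C) : Cmod (Cexp x) = exp (fst x).
Proof.
  unfold Cmod, Cexp; simpl.
  assert (H := sin2_cos2 (snd x)). unfold Rsqr in H.
  replace (_ + _) with (exp (fst x) * exp (fst x)).
  - apply sqrt_square. apply Rlt_le, exp_pos.
  - transitivity (exp (fst x) * exp (fst x) *
      (sin (snd x) * sin (snd x) + cos (snd x) * cos (snd x))); [rewrite H|]; ring.
Qed.

Lemma Cmod_Cexp_segment (s : C) (t : R) : 0 <= t <= 1 ->
  Cmod (Cexp (RtoC t * s)) <= exp (Rmax 0 (fst s)).
Proof.
  intros Ht. rewrite Cmod_Cexp. simpl.
  assert (H : t * fst s - 0 * snd s <= Rmax 0 (fst s)).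
  { destruct (Rle_dec 0 (fst s)).
    - rewrite Rmax_right by assumption. nra.
    - rewrite Rmax_left by lra. nra. }
  destruct H as [H|H]; [apply Rlt_le, exp_increasing, H | rewrite H; lra].
Qed.

(** Along the segment from [0] to [s], the derivative of each Taylor remainder of
    the exponential is [s] times the preceding remainder; this step is iterated
    below. *)
Lemma segment_remainder (f df : R -> C) (t M : R) :
  0 <= t <= 1 -> f 0 = 0 ->
  (forall x, Rderive f x (df x)) ->
  (forall x, 0 < x <= 1 -> Cmod (df x) <= M) -> Cmod (f t) <= M.
Proof.
  intros Ht H0 Hd HM.
  assert (HM0 : 0 <= M) by (eapply Rle_trans; [apply Cmod_ge_0 | apply (HM 1); lra]).
  replace (f t) with (f t - f 0)%C by (rewrite H0; ring).
  eapply Rle_trans; [apply (mean_value_ineq f df 0 t M)|nra]; try lra.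
  - intros x _. apply Hd.
  - intros x _. eapply Rderive_continuous, Hd.
  - intros x Hx. apply HM. lra.
Qed.

Lemma Cexp_taylor1_segment (s : C) (t : R) : 0 <= t <= 1 ->
  Cmod (Cexp (RtoC t * s) - 1) <= Cmod s * exp (Rmax 0 (fst s)).
Proof.
  intros Ht.
  apply (segment_remainder (fun t => Cexp (RtoC t * s) - 1)%C
    (fun t => s * Cexp (RtoC t * s))%C); [exact Ht| | |].
  - replace (RtoC 0 * s)%C with (RtoC 0) by ring. rewrite Cexp_0. ring.
  - intros x. destruct s as [a b]. apply Rderive_pair; unfold Cexp; simpl.
    + auto_derive; [exact I|]. unfold Rminus. ring.
    + auto_derive; [exact I|]. unfold Rminus. ring.
  - intros x Hx. rewrite Cmod_mult. apply Rmult_le_compat_l; [apply Cmod_ge_0|].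
    apply Cmod_Cexp_segment. lra.
Qed.

Lemma Cexp_taylor2_segment (s : C) (t : R) : 0 <= t <= 1 ->
  Cmod (Cexp (RtoC t * s) - 1 - RtoC t * s) <= Cmod s ^ 2 * exp (Rmax 0 (fst s)).
Proof.
  intros Ht.
  apply (segment_remainder (fun t => Cexp (RtoC t * s) - 1 - RtoC t * s)%C
    (fun t => s * (Cexp (RtoC t * s) - 1))%C); [exact Ht| | |].
  - replace (RtoC 0 * s)%C with (RtoC 0) by ring. rewrite Cexp_0. ring.
  - intros x. destruct s as [a b]. apply Rderive_pair; unfold Cexp; simpl.
    + auto_derive; [exact I|]. unfold Rminus. ring.
    + auto_derive; [exact I|]. unfold Rminus. ring.
  - intros x Hx. rewrite Cmod_mult.
    replace (Cmod s ^ 2 * exp (Rmax 0 (fst s)))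
      with (Cmod s * (Cmod s * exp (Rmax 0 (fst s)))) by ring.
    apply Rmult_le_compat_l; [apply Cmod_ge_0|]. apply Cexp_taylor1_segment. lra.
Qed.

Lemma Cexp_taylor3_segment (s : C) (t : R) : 0 <= t <= 1 ->
  Cmod (Cexp (RtoC t * s) - 1 - RtoC t * s - RtoC (t ^ 2 / 2) * (s * s))
    <= Cmod s ^ 3 * exp (Rmax 0 (fst s)).
Proof.
  intros Ht.
  apply (segment_remainder
    (fun t => Cexp (RtoC t * s) - 1 - RtoC t * s - RtoC (t ^ 2 / 2) * (s * s))%C
    (fun t => s * (Cexp (RtoC t * s) - 1 - RtoC t * s))%C); [exact Ht| | |].
  - replace (RtoC 0 * s)%C with (RtoC 0) by ring. rewrite Cexp_0.
    replace (0 ^ 2 / 2) with 0 by field. ring.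
  - intros x. destruct s as [a b]. apply Rderive_pair; unfold Cexp; simpl.
    + auto_derive; [exact I|]. unfold Rminus. field.
    + auto_derive; [exact I|]. unfold Rminus. field.
  - intros x Hx. rewrite Cmod_mult.
    replace (Cmod s ^ 3 * exp (Rmax 0 (fst s)))
      with (Cmod s * (Cmod s ^ 2 * exp (Rmax 0 (fst s)))) by ring.
    apply Rmult_le_compat_l; [apply Cmod_ge_0|]. apply Cexp_taylor2_segment. lra.
Qed.

Lemma Cexp_taylor1 (s : C) : Cmod (Cexp s - 1) <= Cmod s * exp (Rmax 0 (fst s)).
Proof.
  assert (H := Cexp_taylor1_segment s 1). replace (RtoC 1 * s)%C with s in H by ring.
  apply H. lra.
Qed.

Lemma Cexp_taylor2 (s : C) : Cmod (Cexp s - 1 - s) <= Cmod s ^ 2 * exp (Rmax 0 (fst s)).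
Proof.
  assert (H := Cexp_taylor2_segment s 1). replace (RtoC 1 * s)%C with s in H by ring.
  apply H. lra.
Qed.

Lemma Cexp_taylor3 (s : C) :
  Cmod (Cexp s - 1 - s - s * s / 2) <= Cmod s ^ 3 * exp (Rmax 0 (fst s)).
Proof.
  assert (H := Cexp_taylor3_segment s 1). replace (RtoC 1 * s)%C with s in H by ring.
  replace (s * s / 2)%C with (RtoC (1 ^ 2 / 2) * (s * s))%C; [apply H; lra|].
  replace (1 ^ 2 / 2) with (/ 2) by field. rewrite RtoC_inv by lra. unfold Cdiv. ring.
Qed.

Lemma exp_Rmax_bound (s : C) : Cmod s < 1 -> exp (Rmax 0 (fst s)) <= 3.
Proof.
  intros H. eapply Rle_trans; [|apply exp_le_3].
  apply Rlt_le, exp_increasing. apply Rmax_lub_lt; [lra|].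
  assert (K := fst_le_Cmod s). assert (L := Rle_abs (fst s)). lra.
Qed.

Lemma Cderive_Cexp (p : C) : Cderive Cexp p (Cexp p).
Proof.
  apply (Cderive_quadratic _ _ _ 1 (Cmod (Cexp p) * 3)); [lra|]. intros u Hu.
  replace (Cexp u) with (Cexp p * Cexp (u - p))%C
    by (rewrite <- Cexp_plus; f_equal; ring).
  replace (Cexp p * Cexp (u - p) - Cexp p - Cexp p * (u - p))%C
    with (Cexp p * (Cexp (u - p) - 1 - (u - p)))%C by ring.
  rewrite Cmod_mult, Rmult_assoc. apply Rmult_le_compat_l; [apply Cmod_ge_0|].
  eapply Rle_trans; [apply Cexp_taylor2|]. rewrite Rmult_comm.
  apply Rmult_le_compat_r; [apply pow_le, Cmod_ge_0|]. apply exp_Rmax_bound, Hu.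
Qed.

(** * The divided difference of the exponential *)

(** The value at [0] removes the singularity: this is an entire function. *)
Definition expdiff (d : C) : C :=
  if Ceq_dec d 0 then 1 else ((Cexp d - 1) / d)%C.

Lemma expdiff_spec (d : C) : (d * expdiff d = Cexp d - 1)%C.
Proof.
  unfold expdiff. destruct (Ceq_dec d 0) as [->|H].
  - rewrite Cexp_0. ring.
  - field. exact H.
Qed.

Lemma ex_Cderive_expdiff (p : C) : exists l, Cderive expdiff p l.
Proof.
  destruct (Ceq_dec p 0) as [->|Hp].
  - exists (/ 2)%C. apply (Cderive_quadratic _ _ _ 1 3); [lra|]. intros u Hu.
    replace (u - 0)%C with u in * by ring.
    unfold expdiff at 2. destruct (Ceq_dec 0 0) as [_|H]; [|now elim H].
    unfold expdiff. destruct (Ceq_dec u 0) as [->|H0].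
    + replace (1 - 1 - / 2 * 0)%C with (RtoC 0) by ring. rewrite Cmod_0. lra.
    + replace ((Cexp u - 1) / u - 1 - / 2 * u)%C
        with ((Cexp u - 1 - u - u * u / 2) / u)%C by (field; exact H0).
      rewrite Cmod_div by exact H0.
      assert (HU : 0 < Cmod u) by (apply Cmod_gt_0, H0).
      apply (Rmult_le_reg_r (Cmod u)); [exact HU|].
      unfold Rdiv. rewrite Rmult_assoc, Rinv_l, Rmult_1_r by lra.
      eapply Rle_trans; [apply Cexp_taylor3|].
      replace (3 * Cmod u ^ 2 * Cmod u) with (Cmod u ^ 3 * 3) by ring.
      apply Rmult_le_compat_l; [apply pow_le; lra|]. apply exp_Rmax_bound, Hu.
  - eexists. apply (is_derive_ext_loc (K := C_AbsRing) (V := C_NormedModule)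
      (fun u => (Cexp u - 1) * / u)%C).
    + exists (mkposreal _ (proj1 (Cmod_gt_0 p) Hp)). intros u Hu.
      change (Cmod (u - p) < Cmod p) in Hu. unfold expdiff.
      destruct (Ceq_dec u 0) as [->|_]; [|reflexivity].
      replace (0 - p)%C with (- p)%C in Hu by ring. rewrite Cmod_opp in Hu. lra.
    + apply Cderive_mult; [|apply Cderive_inv, Hp].
      apply (Cderive_plus Cexp (fun _ => - (1))%C); [apply Cderive_Cexp|apply Cderive_const].
Qed.

Lemma cos_plus_mul_sin_ge_1 (y : R) : 0 <= y <= PI / 2 -> 1 <= cos y + y * sin y.
Proof.
  intros Hy. destruct (Req_dec y 0) as [->|Hne].
  { rewrite cos_0, sin_0. lra. }
  destruct (MVT_gen (fun y => cos y + y * sin y) 0 y (fun y => y * cos y)) as [c [Hc E]].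
  - intros x _. auto_derive; [exact I|]. ring.
  - intros x _. apply derivable_continuous_pt. auto_derive. exact I.
  - rewrite Rmin_left, Rmax_right in Hc by lra.
    rewrite cos_0, sin_0 in E.
    assert (0 <= cos c) by (apply cos_ge_0; lra).
    assert (0 <= c * cos c) by (apply Rmult_le_pos; lra). nra.
Qed.

(** This is [Re ((e^d - 1) * conj d)] for [d = x + i y], which has the sign of
    the real part of [(e^d - 1) / d]. *)
Lemma exp_cos_sin_pos (x y : R) : Rabs y <= PI / 2 -> (x <> 0 \/ y <> 0) ->
  0 < x * (exp x * cos y - 1) + y * (exp x * sin y).
Proof.
  revert y.
  enough (Pos : forall y, 0 <= y <= PI / 2 -> (x <> 0 \/ y <> 0) ->
    0 < x * (exp x * cos y - 1) + y * (exp x * sin y)).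
  { intros y Hy Hne. destruct (Rle_dec 0 y) as [K|K].
    - apply Pos; [|exact Hne]. rewrite Rabs_pos_eq in Hy by assumption. lra.
    - specialize (Pos (- y)). rewrite cos_neg, sin_neg in Pos.
      replace (y * (exp x * sin y)) with (- y * (exp x * - sin y)) by ring.
      apply Pos; [rewrite Rabs_left in Hy by lra; lra | destruct Hne; [left|right]; lra]. }
  intros y [Hy0 Hy] Hne.
  assert (Hc : 0 <= cos y) by (apply cos_ge_0; lra).
  assert (Hs : 0 <= sin y) by (apply sin_ge_0; lra).
  assert (Hc1 := COS_bound y). assert (He := exp_pos x).
  assert (Hsy : y <> 0 -> 0 < sin y) by (intros; apply sin_gt_0; lra).
  destruct (Rle_dec x 0) as [Hx|Hx].
  - assert (H1 : exp x <= 1).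
    { rewrite <- exp_0. destruct Hx as [Hx|Hx]; [left; apply exp_increasing, Hx|rewrite Hx; lra]. }
    assert (H2 : x <> 0 -> exp x < 1).
    { intros K. rewrite <- exp_0. apply exp_increasing. lra. }
    assert (H3 : exp x * cos y <= exp x) by nra.
    destruct (Req_dec x 0) as [E|E].
    + destruct Hne as [K|K]; [lra|]. specialize (Hsy K). rewrite E, exp_0. nra.
    + specialize (H2 E). assert (0 <= y * (exp x * sin y)) by (apply Rmult_le_pos; nra). nra.
  - assert (H1 := cos_plus_mul_sin_ge_1 y (conj Hy0 Hy)).
    assert (H2 : 1 + x < exp x) by (apply exp_ineq1; lra).
    (* [x cos y + y sin y >= 1 + (x - 1) cos y >= min 1 x] *)
    assert (H3 : x < exp x * (x * cos y + y * sin y)); [|nra].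
    destruct (Rle_dec x 1).
    + assert (H4 : x <= x * cos y + y * sin y) by nra. nra.
    + assert (H4 : 1 <= x * cos y + y * sin y) by nra. nra.
Qed.

Lemma expdiff_re_pos (d : C) : Rabs (snd d) <= PI / 2 -> 0 < fst (expdiff d).
Proof.
  intros H. unfold expdiff. destruct (Ceq_dec d 0) as [_|Hd]; [simpl; lra|].
  destruct d as [x y]. simpl in H.
  assert (Hne : x <> 0 \/ y <> 0).
  { destruct (Req_dec x 0) as [->|]; [right|left; assumption]. intros ->. now apply Hd. }
  assert (P := exp_cos_sin_pos x y H Hne).
  assert (Q : 0 < x * (x * 1) + y * (y * 1)) by (destruct Hne; nra).
  unfold Cexp; simpl.
  replace (_ - _) with
    ((x * (exp x * cos y - 1) + y * (exp x * sin y)) * / (x * (x * 1) + y * (y * 1)))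
    by (field; lra).
  apply Rmult_lt_0_compat; [exact P|apply Rinv_0_lt_compat, Q].
Qed.

(** * Complex-valued integrals *)

Definition CInt (f : R -> C) (a b : R) : C := RInt (V := C_R_CompleteNormedModule) f a b.

Lemma ex_CInt_continuous (f : R -> C) (a b : R) :
  a <= b -> (forall t, a <= t <= b -> continuous f t) -> ex_CInt f a b.
Proof.
  intros Hab H. apply (ex_RInt_continuous (V := C_R_CompleteNormedModule)).
  rewrite Rmin_left, Rmax_right by exact Hab. exact H.
Qed.

Lemma CInt_correct (f : R -> C) (a b : R) : ex_CInt f a b -> is_CInt f a b (CInt f a b).
Proof. apply (RInt_correct (V := C_R_CompleteNormedModule)). Qed.

Lemma is_CInt_unique (f : R -> C) (a b : R) (l : C) : is_CInt f a b l -> CInt f a b = l.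
Proof. apply (is_RInt_unique (V := C_R_CompleteNormedModule)). Qed.

Lemma is_CInt_plus (f g : R -> C) (a b : R) (k l : C) :
  is_CInt f a b k -> is_CInt g a b l -> is_CInt (fun t => f t + g t)%C a b (k + l)%C.
Proof. apply (is_RInt_plus (V := C_R_NormedModule)). Qed.

Lemma is_CInt_minus (f g : R -> C) (a b : R) (k l : C) :
  is_CInt f a b k -> is_CInt g a b l -> is_CInt (fun t => f t - g t)%C a b (k - l)%C.
Proof. apply (is_RInt_minus (V := C_R_NormedModule)). Qed.

Lemma scal_RtoC (x : R) (c : C) : @scal R_AbsRing C_R_NormedModule x c = (RtoC x * c)%C.
Proof.
  apply injective_projections; simpl; unfold scal; simpl; unfold mult; simpl; ring.
Qed.

Lemma is_CInt_const (a b : R) (c : C) : is_CInt (fun _ => c) a b (RtoC (b - a) * c)%C.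
Proof. rewrite <- scal_RtoC. apply (is_RInt_const (V := C_R_NormedModule)). Qed.

Lemma is_CInt_mult_l (c : C) (f : R -> C) (a b : R) (l : C) :
  is_CInt f a b l -> is_CInt (fun t => c * f t)%C a b (c * l)%C.
Proof.
  intros H.
  assert (H1 := is_RInt_fct_extend_fst f a b l H).
  assert (H2 := is_RInt_fct_extend_snd f a b l H).
  apply (is_RInt_fct_extend_pair (fun t => c * f t)%C).
  - apply (is_RInt_minus (V := R_NormedModule));
      apply (is_RInt_scal (V := R_NormedModule)); assumption.
  - apply (is_RInt_plus (V := R_NormedModule));
      apply (is_RInt_scal (V := R_NormedModule)); assumption.
Qed.

Lemma is_CInt_bound (f : R -> C) (a b M : R) (l : C) :
  a <= b -> (forall t, a <= t <= b -> Cmod (f t) <= M) -> is_CInt f a b l ->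
  Cmod l <= (b - a) * M.
Proof.
  intros Hab HM H. rewrite <- norm_Cmod.
  apply (norm_RInt_le_const (V := C_R_NormedModule) f a b); try assumption.
  intros t Ht. rewrite norm_Cmod. apply HM, Ht.
Qed.

Lemma CInt_bound (f : R -> C) (a b M : R) :
  a <= b -> ex_CInt f a b -> (forall t, a <= t <= b -> Cmod (f t) <= M) ->
  Cmod (CInt f a b) <= (b - a) * M.
Proof. intros Hab Hf HM. eapply is_CInt_bound; eauto using CInt_correct. Qed.

Lemma CInt_Chasles (f : R -> C) (a b c : R) :
  ex_CInt f a b -> ex_CInt f b c -> (CInt f a b + CInt f b c)%C = CInt f a c.
Proof. apply (RInt_Chasles (V := C_R_CompleteNormedModule)). Qed.

Lemma CInt_ext (f g : R -> C) (a b : R) :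
  (forall t, Rmin a b < t < Rmax a b -> f t = g t) -> CInt f a b = CInt g a b.
Proof. apply (RInt_ext (V := C_R_CompleteNormedModule)). Qed.

Lemma CInt_ftc (f df : R -> C) (a b : R) : a <= b ->
  (forall t, a <= t <= b -> Rderive f t (df t)) ->
  (forall t, a <= t <= b -> continuous df t) ->
  is_CInt df a b (f b - f a)%C.
Proof.
  intros Hab Hd Hc.
  apply (is_RInt_derive (V := C_R_CompleteNormedModule)); rewrite Rmin_left, Rmax_right
    by exact Hab; assumption.
Qed.

(** * Cauchy-Goursat for curvilinear rectangles *)

(** Holomorphy of [f] on the image of a rectangle under [g]. The bound [M] is part
    of the data because the local estimate needs one Lipschitz constant for all
    subrectangles. *)
Record holomorphic_rect (f : C -> C) (g gr gv : R -> R -> C) (a b c d M : R) : Prop := {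
  rect_dr : forall r v, a <= r <= b -> c <= v <= d -> Rderive (fun r => g r v) r (gr r v);
  rect_dv : forall r v, a <= r <= b -> c <= v <= d -> Rderive (fun v => g r v) v (gv r v);
  rect_cr : forall r v, a <= r <= b -> c <= v <= d -> continuous (fun r => gr r v) r;
  rect_cv : forall r v, a <= r <= b -> c <= v <= d -> continuous (fun v => gv r v) v;
  rect_br : forall r v, a <= r <= b -> c <= v <= d -> Cmod (gr r v) <= M;
  rect_bv : forall r v, a <= r <= b -> c <= v <= d -> Cmod (gv r v) <= M;
  rect_hol : forall r v, a <= r <= b -> c <= v <= d -> exists l, Cderive f (g r v) l }.

Lemma holomorphic_rect_sub (f : C -> C) (g gr gv : R -> R -> C) (a b c d M a' b' c' d' : R) :
  holomorphic_rect f g gr gv a b c d M ->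
  a <= a' -> b' <= b -> c <= c' -> d' <= d -> holomorphic_rect f g gr gv a' b' c' d' M.
Proof.
  intros [H1 H2 H3 H4 H5 H6 H7] Ha Hb Hc Hd.
  split; intros r v Hr Hv; [apply H1|apply H2|apply H3|apply H4|apply H5|apply H6|apply H7]; lra.
Qed.

Definition boundary_integral (f : C -> C) (g gr gv : R -> R -> C) (a b c d : R) : C :=
  (CInt (fun r => f (g r c) * gr r c)%C a b + CInt (fun v => f (g b v) * gv b v)%C c d
   - CInt (fun r => f (g r d) * gr r d)%C a b - CInt (fun v => f (g a v) * gv a v)%C c d)%C.

Lemma rect_continuous (f : C -> C) (g gr gv : R -> R -> C) (a b c d M r v : R) :
  holomorphic_rect f g gr gv a b c d M -> a <= r <= b -> c <= v <= d ->
  continuous (fun r => f (g r v) * gr r v)%C r /\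
  continuous (fun v => f (g r v) * gv r v)%C v.
Proof.
  intros H Hr Hv. destruct (rect_hol _ _ _ _ _ _ _ _ _ H r v Hr Hv) as [l Hl].
  apply Cderive_continuous in Hl. split; apply continuous_Cmult.
  - apply (continuous_comp (fun r => g r v) f); [|exact Hl].
    eapply Rderive_continuous, (rect_dr _ _ _ _ _ _ _ _ _ H); assumption.
  - apply (rect_cr _ _ _ _ _ _ _ _ _ H); assumption.
  - apply (continuous_comp (fun v => g r v) f); [|exact Hl].
    eapply Rderive_continuous, (rect_dv _ _ _ _ _ _ _ _ _ H); assumption.
  - apply (rect_cv _ _ _ _ _ _ _ _ _ H); assumption.
Qed.

Lemma rect_ex_CInt (f : C -> C) (g gr gv : R -> R -> C) (a b c d M : R) :
  holomorphic_rect f g gr gv a b c d M ->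
  (forall v p q, c <= v <= d -> a <= p -> p <= q -> q <= b ->
     ex_CInt (fun r => f (g r v) * gr r v)%C p q) /\
  (forall r p q, a <= r <= b -> c <= p -> p <= q -> q <= d ->
     ex_CInt (fun v => f (g r v) * gv r v)%C p q).
Proof.
  intros H. split.
  - intros v p q Hv Hp Hpq Hq. apply ex_CInt_continuous; [exact Hpq|]. intros r Hr.
    apply (rect_continuous f g gr gv a b c d M r v H); lra.
  - intros r p q Hr Hp Hpq Hq. apply ex_CInt_continuous; [exact Hpq|]. intros v Hv.
    apply (rect_continuous f g gr gv a b c d M r v H); lra.
Qed.

Lemma boundary_integral_split (f : C -> C) (g gr gv : R -> R -> C) (a m b c n d M : R) :
  holomorphic_rect f g gr gv a b c d M -> a <= m <= b -> c <= n <= d ->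
  boundary_integral f g gr gv a b c d =
  (boundary_integral f g gr gv a m c n + boundary_integral f g gr gv m b c n +
   boundary_integral f g gr gv a m n d + boundary_integral f g gr gv m b n d)%C.
Proof.
  intros H Hm Hn. destruct (rect_ex_CInt _ _ _ _ _ _ _ _ _ H) as [E1 E2].
  unfold boundary_integral.
  rewrite <- (CInt_Chasles (fun r => f (g r c) * gr r c)%C a m b) by (apply E1; lra).
  rewrite <- (CInt_Chasles (fun r => f (g r d) * gr r d)%C a m b) by (apply E1; lra).
  rewrite <- (CInt_Chasles (fun v => f (g a v) * gv a v)%C c n d) by (apply E2; lra).
  rewrite <- (CInt_Chasles (fun v => f (g b v) * gv b v)%C c n d) by (apply E2; lra).
  ring.
Qed.

(** An affine function has a primitive, so it contributes nothing; what is left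
    of [f] near [p] is small compared with the distance to [p]. *)
Lemma boundary_integral_local (f : C -> C) (g gr gv : R -> R -> C) (a b c d M r0 v0 eps : R) :
  holomorphic_rect f g gr gv a b c d M -> a <= r0 <= b -> c <= v0 <= d -> 0 < eps ->
  exists delta, 0 < delta /\ forall a' b' c' d',
    a <= a' <= r0 -> r0 <= b' <= b -> c <= c' <= v0 -> v0 <= d' <= d ->
    (b' - a') + (d' - c') < delta ->
    Cmod (boundary_integral f g gr gv a' b' c' d')
      <= eps * ((b' - a') + (d' - c')) ^ 2.
Proof.
  intros H Hr0 Hv0 He.
  set (p := g r0 v0).
  destruct (rect_hol _ _ _ _ _ _ _ _ _ H r0 v0 Hr0 Hv0) as [l Hl]. fold p in Hl.
  assert (HM : 0 <= M).
  { eapply Rle_trans; [apply Cmod_ge_0|].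
    apply (rect_br _ _ _ _ _ _ _ _ _ H r0 v0); assumption. }
  set (e1 := eps / (2 * (M + 1) * (M + 1))).
  assert (He1 : 0 < e1) by (apply Rdiv_lt_0_compat; [lra|nra]).
  rewrite Cderive_eps in Hl. destruct (Hl e1 He1) as [eta [Heta K]].
  exists (eta / (M + 1)). split; [apply Rdiv_lt_0_compat; lra|].
  intros a' b' c' d' Ha Hb Hc Hd Hsmall.
  set (s := (b' - a') + (d' - c')) in *.
  assert (Hs : 0 <= s) by (unfold s; lra).
  assert (H' : holomorphic_rect f g gr gv a' b' c' d' M)
    by (apply (holomorphic_rect_sub _ _ _ _ a b c d); trivial; lra).
  assert (Dist : forall r v, a' <= r <= b' -> c' <= v <= d' -> Cmod (g r v - p) <= M * s).
  { intros r v Hr Hv.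
    assert (Aux : forall (F dF : R -> C) x y, (forall t, Rmin x y <= t <= Rmax x y ->
       Rderive F t (dF t) /\ Cmod (dF t) <= M) -> Cmod (F x - F y) <= M * Rabs (x - y)).
    { intros F dF x y HF. destruct (Rle_dec x y) as [L|L].
      - rewrite Rmin_left, Rmax_right in HF by lra.
        replace (F x - F y)%C with (- (F y - F x))%C by ring. rewrite Cmod_opp.
        rewrite Rabs_minus_sym, Rabs_pos_eq by lra.
        apply (mean_value_ineq F dF); [lra| | |]; intros t Ht.
        + apply HF; lra.
        + eapply Rderive_continuous. apply HF; lra.
        + apply HF; lra.
      - rewrite Rmin_right, Rmax_left in HF by lra.
        rewrite Rabs_pos_eq by lra.
        apply (mean_value_ineq F dF); [lra| | |]; intros t Ht.
        + apply HF; lra.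
        + eapply Rderive_continuous. apply HF; lra.
        + apply HF; lra. }
    replace (g r v - p)%C with ((g r v - g r v0) + (g r v0 - p))%C by ring.
    eapply Rle_trans; [apply Cmod_triangle|].
    assert (A1 : Cmod (g r v - g r v0) <= M * Rabs (v - v0)).
    { apply (Aux (fun v => g r v) (fun v => gv r v)). intros t Ht.
      assert (Ht' : c' <= t <= d').
      { split; [eapply Rle_trans; [|apply Ht]; apply Rmin_glb; lra
               |eapply Rle_trans; [apply Ht|]; apply Rmax_lub; lra]. }
      split; [apply (rect_dv _ _ _ _ _ _ _ _ _ H')|apply (rect_bv _ _ _ _ _ _ _ _ _ H')];
        lra. }
    assert (A2 : Cmod (g r v0 - p) <= M * Rabs (r - r0)).
    { apply (Aux (fun r => g r v0) (fun r => gr r v0)). intros t Ht.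
      assert (Ht' : a' <= t <= b').
      { split; [eapply Rle_trans; [|apply Ht]; apply Rmin_glb; lra
               |eapply Rle_trans; [apply Ht|]; apply Rmax_lub; lra]. }
      split; [apply (rect_dr _ _ _ _ _ _ _ _ _ H')|apply (rect_br _ _ _ _ _ _ _ _ _ H')];
        lra. }
    assert (B1 : Rabs (v - v0) <= d' - c') by (apply Rabs_le; lra).
    assert (B2 : Rabs (r - r0) <= b' - a') by (apply Rabs_le; lra).
    unfold s. nra. }
  set (T := fun u => (f p + l * (u - p))%C).
  set (Phi := fun u => (f p * (u - p) + l * ((u - p) * (u - p)) / 2)%C).
  assert (HT : forall u, Cderive Phi u (T u)).
  { intros u. unfold Phi, T.
    assert (Hid : Cderive (fun u => u - p)%C u (RtoC 1)).
    { eapply Cderive_eq; [apply (Cderive_plus (fun u => u) (fun _ => - p)%C);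
        [apply Cderive_id|apply Cderive_const]|ring]. }
    eapply Cderive_eq.
    - apply (Cderive_plus (fun u => f p * (u - p))%C
        (fun u => l * ((u - p) * (u - p)) * / 2)%C).
      + apply Cderive_mult; [apply Cderive_const|exact Hid].
      + apply Cderive_mult; [|apply Cderive_const].
        apply Cderive_mult; [apply Cderive_const|].
        apply Cderive_mult; exact Hid.
    - cbv beta. replace (RtoC 2) with (1 + 1)%C by (rewrite <- RtoC_plus; reflexivity).
      field. }
  assert (HcT : forall u, continuous T u).
  { intros u. apply (Cderive_continuous T u l). unfold T.
    eapply Cderive_eq.
    - apply (Cderive_plus (fun _ => f p) (fun u => l * (u + - p))%C); [apply Cderive_const|].
      apply Cderive_mult; [apply Cderive_const|].
      apply (Cderive_plus (fun u => u) (fun _ => - p)%C);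
        [apply Cderive_id|apply Cderive_const].
    - cbv beta. ring. }
  assert (Edge : forall (q dq : R -> C) x y, x <= y ->
     (forall t, x <= t <= y -> Rderive q t (dq t) /\ continuous dq t /\ Cmod (dq t) <= M /\
        Cmod (q t - p) <= M * s) ->
     ex_CInt (fun t => f (q t) * dq t)%C x y ->
     Cmod (CInt (fun t => f (q t) * dq t)%C x y - (Phi (q y) - Phi (q x)))
       <= (y - x) * (e1 * (M * s) * M)).
  { intros q dq x y Hxy Hq Hex.
    assert (I1 : is_CInt (fun t => T (q t) * dq t)%C x y (Phi (q y) - Phi (q x))%C).
    { apply (CInt_ftc (fun t => Phi (q t))); [exact Hxy| |].
      - intros t Ht. apply Rderive_comp; [apply HT|apply Hq, Ht].
      - intros t Ht. apply continuous_Cmult; [|apply Hq, Ht].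
        apply (continuous_comp q T); [|apply HcT].
        eapply Rderive_continuous, Hq, Ht. }
    apply (is_CInt_bound (fun t => f (q t) * dq t - T (q t) * dq t)%C); [exact Hxy| |].
    - intros t Ht. destruct (Hq t Ht) as [_ [_ [Hb1 Hb2]]].
      replace (f (q t) * dq t - T (q t) * dq t)%C
        with ((f (q t) - f p - l * (q t - p)) * dq t)%C by (unfold T; ring).
      rewrite Cmod_mult. apply Rmult_le_compat; try apply Cmod_ge_0; [|exact Hb1].
      eapply Rle_trans; [apply K|apply Rmult_le_compat_l; [lra|exact Hb2]].
      eapply Rle_lt_trans; [exact Hb2|].
      apply (Rmult_lt_compat_l (M + 1)) in Hsmall; [|lra].
      replace ((M + 1) * (eta / (M + 1))) with eta in Hsmall by (field; lra). nra.
    - apply is_CInt_minus; [apply CInt_correct, Hex|exact I1]. }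
  destruct (rect_ex_CInt _ _ _ _ _ _ _ _ _ H') as [E1 E2].
  assert (Er : forall v, c' <= v <= d' ->
     Cmod (CInt (fun r => f (g r v) * gr r v)%C a' b' - (Phi (g b' v) - Phi (g a' v)))
       <= (b' - a') * (e1 * (M * s) * M)).
  { intros v Hv. apply (Edge (fun r => g r v) (fun r => gr r v)); [lra| |apply E1; lra].
    intros t Ht. split; [apply (rect_dr _ _ _ _ _ _ _ _ _ H'); lra|].
    split; [apply (rect_cr _ _ _ _ _ _ _ _ _ H'); lra|].
    split; [apply (rect_br _ _ _ _ _ _ _ _ _ H'); lra|apply Dist; lra]. }
  assert (Ev : forall r, a' <= r <= b' ->
     Cmod (CInt (fun v => f (g r v) * gv r v)%C c' d' - (Phi (g r d') - Phi (g r c')))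
       <= (d' - c') * (e1 * (M * s) * M)).
  { intros r Hr. apply (Edge (fun v => g r v) (fun v => gv r v)); [lra| |apply E2; lra].
    intros t Ht. split; [apply (rect_dv _ _ _ _ _ _ _ _ _ H'); lra|].
    split; [apply (rect_cv _ _ _ _ _ _ _ _ _ H'); lra|].
    split; [apply (rect_bv _ _ _ _ _ _ _ _ _ H'); lra|apply Dist; lra]. }
  assert (W1 := Er c' ltac:(lra)). assert (W2 := Ev b' ltac:(lra)).
  assert (W3 := Er d' ltac:(lra)). assert (W4 := Ev a' ltac:(lra)).
  unfold boundary_integral.
  set (A1 := CInt (fun r => f (g r c') * gr r c')%C a' b') in *.
  set (A2 := CInt (fun v => f (g b' v) * gv b' v)%C c' d') in *.
  set (A3 := CInt (fun r => f (g r d') * gr r d')%C a' b') in *.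
  set (A4 := CInt (fun v => f (g a' v) * gv a' v)%C c' d') in *.
  replace (A1 + A2 - A3 - A4)%C with
    ((A1 - (Phi (g b' c') - Phi (g a' c'))) + (A2 - (Phi (g b' d') - Phi (g b' c')))
     + - (A3 - (Phi (g b' d') - Phi (g a' d'))) + - (A4 - (Phi (g a' d') - Phi (g a' c'))))%C
    by ring.
  eapply Rle_trans; [apply Cmod_triangle|].
  eapply Rle_trans; [apply Rplus_le_compat_r; eapply Rle_trans; [apply Cmod_triangle|];
     apply Rplus_le_compat_r; apply Cmod_triangle|].
  rewrite !Cmod_opp.
  set (Q := e1 * (M * s) * M) in *.
  apply Rle_trans with (2 * s * Q); [unfold s; lra|]. unfold Q.
  replace (2 * s * (e1 * (M * s) * M)) with (e1 * (2 * M * M) * s ^ 2) by ring.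
  apply Rmult_le_compat_r; [apply pow2_ge_0|].
  replace eps with (e1 * (2 * (M + 1) * (M + 1))) by (unfold e1; field; lra).
  apply Rmult_le_compat_l; [lra|]. nra.
Qed.

(** An informative disjunction, so that the choice of a quarter can be iterated
    as a function. *)
Lemma Cmod_pigeonhole (x y z t : C) (m : R) : m <= Cmod (x + y + z + t) ->
  {m <= 4 * Cmod x} + {m <= 4 * Cmod y} + {m <= 4 * Cmod z} + {m <= 4 * Cmod t}.
Proof.
  intros H.
  destruct (Rle_dec m (4 * Cmod x)) as [A1|A1]; [now left; left; left|].
  destruct (Rle_dec m (4 * Cmod y)) as [A2|A2]; [now left; left; right|].
  destruct (Rle_dec m (4 * Cmod z)) as [A3|A3]; [now left; right|].
  right. assert (T1 := Cmod_triangle (x + y + z) t).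
  assert (T2 := Cmod_triangle (x + y) z). assert (T3 := Cmod_triangle x y). lra.
Qed.

Lemma nested_point (x : nat -> R) (h : R) :
  (forall n, x n <= x (S n) /\ x (S n) + h / 2 ^ S n <= x n + h / 2 ^ n) ->
  0 <= h -> exists L, forall n, x n <= L <= x n + h / 2 ^ n.
Proof.
  intros H Hh.
  assert (Hp : forall n, 0 <= h / 2 ^ n).
  { intros n. apply Rmult_le_pos; [exact Hh|]. apply Rlt_le, Rinv_0_lt_compat, pow_lt. lra. }
  assert (Up : forall m n, x n <= x (n + m)%nat /\
     x (n + m)%nat + h / 2 ^ (n + m) <= x n + h / 2 ^ n).
  { induction m; intros n.
    - rewrite Nat.add_0_r. lra.
    - rewrite Nat.add_succ_r. specialize (IHm n). specialize (H (n + m)%nat). lra. }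
  assert (Ub : forall m n, x m <= x n + h / 2 ^ n).
  { intros m n. destruct (Nat.le_ge_cases m n) as [L|L].
    - destruct (Up (n - m)%nat m) as [U _].
      replace (m + (n - m))%nat with n in U by (rewrite Nat.add_comm, Nat.sub_add; trivial).
      specialize (Hp n). lra.
    - destruct (Up (m - n)%nat n) as [_ U].
      replace (n + (m - n))%nat with m in U by (rewrite Nat.add_comm, Nat.sub_add; trivial).
      specialize (Hp m). lra. }
  destruct (completeness (fun y => exists n, y = x n)) as [L [HL1 HL2]].
  - exists (x 0%nat + h / 2 ^ 0). intros y [n ->]. apply Ub.
  - exists (x 0%nat), 0%nat. reflexivity.
  - exists L. intros n. split.
    + apply HL1. now exists n.
    + apply HL2. intros y [m ->]. apply Ub.
Qed.

(** At each bisection some quarter keeps at least a fourth of the boundary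
    integral. The integral over the n-th rectangle is thus at least [4^(-n)]
    times the original one, whereas [boundary_integral_local] makes it
    [o(4^(-n))] around the limit point. *)
Lemma cauchy_goursat (f : C -> C) (g gr gv : R -> R -> C) (a b c d M : R) :
  a <= b -> c <= d -> holomorphic_rect f g gr gv a b c d M ->
  boundary_integral f g gr gv a b c d = 0.
Proof.
  intros Hab Hcd H.
  set (h := b - a). set (k := d - c).
  set (B := fun n (p : R * R) => boundary_integral f g gr gv
     (fst p) (fst p + h / 2 ^ n) (snd p) (snd p + k / 2 ^ n)).
  assert (Hp2 : forall n, 0 < 2 ^ n) by (intros; apply pow_lt; lra).
  assert (Hh : forall n, 0 <= h / 2 ^ n).
  { intros n. apply Rmult_le_pos; [unfold h; lra|]. apply Rlt_le, Rinv_0_lt_compat, Hp2. }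
  assert (Hk : forall n, 0 <= k / 2 ^ n).
  { intros n. apply Rmult_le_pos; [unfold k; lra|]. apply Rlt_le, Rinv_0_lt_compat, Hp2. }
  assert (Hhalf : forall x n, x / 2 ^ S n = x / 2 ^ n / 2).
  { intros x n. simpl. field. apply Rgt_not_eq, Hp2. }
  set (inside := fun n (p : R * R) =>
     a <= fst p /\ fst p + h / 2 ^ n <= b /\ c <= snd p /\ snd p + k / 2 ^ n <= d).
  assert (Step : forall n p, inside n p -> {q | inside (S n) q /\
     Cmod (B n p) <= 4 * Cmod (B (S n) q) /\
     (fst p <= fst q /\ fst q + h / 2 ^ S n <= fst p + h / 2 ^ n) /\
     (snd p <= snd q /\ snd q + k / 2 ^ S n <= snd p + k / 2 ^ n)}).
  { intros n [r v] Hin. unfold inside, B in *. simpl fst in *; simpl snd in *.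
    specialize (Hh n). specialize (Hk n). rewrite !Hhalf.
    set (x := h / 2 ^ n) in *. set (y := k / 2 ^ n) in *.
    assert (Hsub : holomorphic_rect f g gr gv r (r + x) v (v + y) M)
      by (apply (holomorphic_rect_sub _ _ _ _ a b c d); trivial; lra).
    assert (S4 := boundary_integral_split f g gr gv r (r + x / 2) (r + x)
      v (v + y / 2) (v + y) M Hsub ltac:(lra) ltac:(lra)).
    destruct (Cmod_pigeonhole _ _ _ _ (Cmod (boundary_integral f g gr gv r (r + x) v (v + y)))
      (Req_le _ _ (f_equal Cmod S4))) as [[[P|P]|P]|P].
    - exists (r, v). simpl fst; simpl snd. split; [lra|]. split; [exact P|lra].
    - exists (r + x / 2, v). simpl fst; simpl snd. split; [lra|]. split; [|lra].
      replace (r + x / 2 + x / 2) with (r + x) by field. exact P.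
    - exists (r, v + y / 2). simpl fst; simpl snd. split; [lra|]. split; [|lra].
      replace (v + y / 2 + y / 2) with (v + y) by field. exact P.
    - exists (r + x / 2, v + y / 2). simpl fst; simpl snd. split; [lra|]. split; [|lra].
      replace (r + x / 2 + x / 2) with (r + x) by field.
      replace (v + y / 2 + y / 2) with (v + y) by field. exact P. }
  assert (H00 : inside 0%nat (a, c)).
  { unfold inside, h, k; simpl. lra. }
  set (seq := nat_rect (fun n => {p | inside n p}) (exist _ (a, c) H00)
    (fun n s => let (q, Hq) := Step n (proj1_sig s) (proj2_sig s) in
       exist (inside (S n)) q (proj1 Hq))).
  set (p := fun n => proj1_sig (seq n)).
  assert (Hnext : forall n, inside n (p n) /\
     Cmod (B n (p n)) <= 4 * Cmod (B (S n) (p (S n))) /\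
     (fst (p n) <= fst (p (S n)) /\ fst (p (S n)) + h / 2 ^ S n <= fst (p n) + h / 2 ^ n) /\
     (snd (p n) <= snd (p (S n)) /\ snd (p (S n)) + k / 2 ^ S n <= snd (p n) + k / 2 ^ n)).
  { intros n. split; [exact (proj2_sig (seq n))|]. unfold p. simpl.
    destruct (Step n (proj1_sig (seq n)) (proj2_sig (seq n))) as [q Hq]. exact (proj2 Hq). }
  assert (Grow : forall n, Cmod (B 0%nat (p 0%nat)) <= 4 ^ n * Cmod (B n (p n))).
  { induction n; [simpl; lra|]. destruct (Hnext n) as [_ [K _]].
    eapply Rle_trans; [exact IHn|].
    replace (4 ^ S n * Cmod (B (S n) (p (S n)))) with (4 ^ n * (4 * Cmod (B (S n) (p (S n)))))
      by (simpl; ring).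
    apply Rmult_le_compat_l; [apply pow_le; lra|exact K]. }
  destruct (nested_point (fun n => fst (p n)) h) as [r0 Hr0].
  { intros n. apply (Hnext n). } { unfold h; lra. }
  destruct (nested_point (fun n => snd (p n)) k) as [v0 Hv0].
  { intros n. apply (Hnext n). } { unfold k; lra. }
  assert (E0 : boundary_integral f g gr gv a b c d = B 0%nat (p 0%nat)).
  { unfold B, p, h, k; simpl. f_equal; field. }
  apply Cmod_eq_0. rewrite E0.
  apply Rle_antisym; [|apply Cmod_ge_0].
  apply Rnot_lt_le. intros Hpos.
  set (m := Cmod (B 0%nat (p 0%nat))) in *.
  destruct (boundary_integral_local f g gr gv a b c d M r0 v0 (m / (2 * ((h + k) ^ 2 + 1))))
    as [delta [Hdelta Loc]]; trivial.
  { specialize (Hr0 0%nat). unfold h in Hr0; simpl in Hr0. lra. }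
  { specialize (Hv0 0%nat). unfold k in Hv0; simpl in Hv0. lra. }
  { apply Rdiv_lt_0_compat; [exact Hpos|]. assert (Q := pow2_ge_0 (h + k)). lra. }
  destruct (pow_lt_1_zero (/ 2)) with (y := delta / (h + k + 1)) as [n Hn].
  { rewrite Rabs_pos_eq; lra. }
  { apply Rdiv_lt_0_compat; unfold h, k; lra. }
  specialize (Hn n (Nat.le_refl n)).
  rewrite Rabs_pos_eq in Hn by (apply pow_le; lra).
  rewrite pow_inv in Hn.
  destruct (Hnext n) as [[I1 [I2 [I3 I4]]] _].
  specialize (Hr0 n). specialize (Hv0 n).
  assert (Hsz : h / 2 ^ n + k / 2 ^ n < delta).
  { apply (Rmult_lt_compat_l (h + k + 1)) in Hn; [|unfold h, k; lra].
    replace ((h + k + 1) * (delta / (h + k + 1))) with delta in Hn by (field; unfold h, k; lra).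
    assert (Q := Rinv_0_lt_compat _ (Hp2 n)). unfold Rdiv. lra. }
  specialize (Loc (fst (p n)) (fst (p n) + h / 2 ^ n) (snd (p n)) (snd (p n) + k / 2 ^ n)).
  assert (L : Cmod (B n (p n)) <= m / (2 * ((h + k) ^ 2 + 1)) * ((h + k) / 2 ^ n) ^ 2).
  { eapply Rle_trans; [apply Loc; lra|]. apply Req_le. f_equal. f_equal. unfold Rdiv. ring. }
  specialize (Grow n).
  assert (E4 : 4 ^ n = 2 ^ n * 2 ^ n) by (rewrite <- Rpow_mult_distr; f_equal; lra).
  assert (F : 4 ^ n * Cmod (B n (p n)) <= m / (2 * ((h + k) ^ 2 + 1)) * (h + k) ^ 2).
  { rewrite E4. specialize (Hp2 n).
    replace (m / (2 * ((h + k) ^ 2 + 1)) * (h + k) ^ 2) with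
      (2 ^ n * 2 ^ n * (m / (2 * ((h + k) ^ 2 + 1)) * ((h + k) / 2 ^ n) ^ 2)).
    - apply Rmult_le_compat_l; [nra|exact L].
    - assert (Q := pow2_ge_0 (h + k)). field. split; lra. }
  assert (Q := pow2_ge_0 (h + k)).
  assert (G : m / (2 * ((h + k) ^ 2 + 1)) * (h + k) ^ 2 < m); [|lra].
  apply (Rmult_lt_reg_r (2 * ((h + k) ^ 2 + 1))); [lra|].
  replace (m / (2 * ((h + k) ^ 2 + 1)) * (h + k) ^ 2 * (2 * ((h + k) ^ 2 + 1)))
    with (m * (h + k) ^ 2) by (field; lra).
  nra.
Qed.

(** * The contour on which [zeta e^zeta] is real and negative *)

Lemma power_growth (f df : R -> R) (n : nat) (v : R) :
  (forall c, is_derive f c (df c)) -> (forall c, Rabs (df c) <= Rabs c ^ n) ->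
  Rabs (f v - f 0) <= Rabs v ^ S n.
Proof.
  intros Hd Hb.
  destruct (MVT_abs f df 0 v) as [c [E Hc]].
  - intros c _. apply is_derive_Reals, Hd.
  - rewrite Rminus_0_r in E. rewrite E. simpl. rewrite Rmult_comm.
    apply Rmult_le_compat_l; [apply Rabs_pos|].
    eapply Rle_trans; [apply Hb|]. apply pow_incr. split; [apply Rabs_pos|].
    rewrite Rmin_comm, Rmax_comm in Hc. apply Rabs_le_between_min_max in Hc.
    rewrite !Rminus_0_r in Hc. exact Hc.
Qed.

Lemma Rabs_sin_le (v : R) : Rabs (sin v) <= Rabs v.
Proof.
  assert (H := power_growth sin cos 0 v). rewrite sin_0, Rminus_0_r in H. simpl in H.
  rewrite Rmult_1_r in H. apply H; [apply is_derive_sin|].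
  intros c. apply Rabs_le, COS_bound.
Qed.

Lemma Rabs_cos_minus_1_le (v : R) : Rabs (cos v - 1) <= Rabs v ^ 2.
Proof.
  rewrite <- cos_0. apply (power_growth cos (fun x => - sin x)); [apply is_derive_cos|].
  intros c. rewrite Rabs_Ropp. simpl. rewrite Rmult_1_r. apply Rabs_sin_le.
Qed.

Lemma Rabs_sin_minus_id_le (v : R) : Rabs (sin v - v) <= Rabs v ^ 3.
Proof.
  replace (sin v - v) with ((fun x => sin x - x) v - (fun x => sin x - x) 0)
    by (cbv beta; rewrite sin_0; ring).
  apply (power_growth (fun x => sin x - x) (fun x => cos x - 1)); [|apply Rabs_cos_minus_1_le].
  intros c. auto_derive; [exact I|ring].
Qed.

Lemma Rabs_mul_cos_minus_sin_le (v : R) : Rabs (v * cos v - sin v) <= Rabs v ^ 3.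
Proof.
  replace (v * cos v - sin v)
    with ((fun x => x * cos x - sin x) v - (fun x => x * cos x - sin x) 0)
    by (cbv beta; rewrite sin_0; ring).
  apply (power_growth (fun x => x * cos x - sin x) (fun x => - (x * sin x))).
  - intros c. auto_derive; [exact I|ring].
  - intros c. rewrite Rabs_Ropp, Rabs_mult. simpl. rewrite Rmult_1_r.
    apply Rmult_le_compat_l; [apply Rabs_pos|apply Rabs_sin_le].
Qed.

Definition sinc (v : R) : R := if Req_dec_T v 0 then 1 else sin v / v.

Definition dsinc (v : R) : R :=
  if Req_dec_T v 0 then 0 else (v * cos v - sin v) / v ^ 2.

Lemma sinc_spec (v : R) : v * sinc v = sin v.
Proof.
  unfold sinc. destruct (Req_dec_T v 0) as [->|H]; [rewrite sin_0; ring|field; exact H].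
Qed.

Lemma dsinc_spec (v : R) : v * dsinc v = cos v - sinc v.
Proof.
  unfold sinc, dsinc. destruct (Req_dec_T v 0) as [->|H]; [rewrite cos_0; ring|field; exact H].
Qed.

Lemma sinc_opp (v : R) : sinc (- v) = sinc v.
Proof.
  unfold sinc. destruct (Req_dec_T v 0), (Req_dec_T (- v) 0); try lra.
  rewrite sin_neg. field. assumption.
Qed.

Lemma dsinc_opp (v : R) : dsinc (- v) = - dsinc v.
Proof.
  unfold dsinc. destruct (Req_dec_T v 0), (Req_dec_T (- v) 0); try lra.
  rewrite sin_neg, cos_neg. field. assumption.
Qed.

Lemma locally_neq_0 (v : R) : v <> 0 -> locally v (fun x => x <> 0).
Proof.
  intros H. exists (mkposreal _ (Rabs_pos_lt v H)). intros y Hy ->.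
  change (Rabs (0 - v) < Rabs v) in Hy. rewrite Rminus_0_l, Rabs_Ropp in Hy. lra.
Qed.

Lemma is_derive_sinc (v : R) : is_derive sinc v (dsinc v).
Proof.
  unfold dsinc. destruct (Req_dec_T v 0) as [->|H].
  - apply is_derive_Reals. intros eps He. exists (mkposreal _ He). intros h Hh Hlt.
    simpl in Hlt. rewrite Rplus_0_l. unfold sinc.
    destruct (Req_dec_T h 0); [lra|]. destruct (Req_dec_T 0 0); [|lra].
    replace ((sin h / h - 1) / h - 0) with ((sin h - h) * / (h * h)) by (field; exact Hh).
    assert (P : 0 < Rabs h) by (apply Rabs_pos_lt, Hh).
    rewrite Rabs_mult, Rabs_inv, Rabs_mult.
    apply Rle_lt_trans with (Rabs h); [|exact Hlt].
    apply (Rmult_le_reg_r (Rabs h * Rabs h)); [nra|].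
    rewrite Rmult_assoc, Rinv_l, Rmult_1_r by nra.
    eapply Rle_trans; [apply Rabs_sin_minus_id_le|]. apply Req_le. ring.
  - apply (is_derive_ext_loc (fun x => sin x / x)).
    + generalize (locally_neq_0 v H). apply filter_imp. intros x Hx. unfold sinc.
      destruct (Req_dec_T x 0); [lra|reflexivity].
    + auto_derive; [exact H|]. field. exact H.
Qed.

Lemma continuous_dsinc (v : R) : continuous dsinc v.
Proof.
  destruct (Req_dec_T v 0) as [->|H].
  - apply filterlim_locally. intros eps. exists eps. intros y Hy.
    change (Rabs (y - 0) < eps) in Hy. change (Rabs (dsinc y - dsinc 0) < eps).
    unfold dsinc. destruct (Req_dec_T 0 0); [|lra].
    rewrite Rminus_0_r in *. destruct (Req_dec_T y 0) as [E|E].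
    { rewrite Rabs_R0. apply cond_pos. }
    apply Rle_lt_trans with (2 := Hy).
    assert (P : 0 < Rabs y) by (apply Rabs_pos_lt, E).
    unfold Rdiv. rewrite Rabs_mult, Rabs_inv, <- RPow_abs.
    apply (Rmult_le_reg_r (Rabs y ^ 2)); [apply pow_lt, P|].
    rewrite Rmult_assoc, Rinv_l, Rmult_1_r by (apply Rgt_not_eq, pow_lt, P).
    eapply Rle_trans; [apply Rabs_mul_cos_minus_sin_le|]. apply Req_le. ring.
  - apply (continuous_ext_loc _ (fun x => (x * cos x - sin x) / x ^ 2)).
    + generalize (locally_neq_0 v H). apply filter_imp. intros x Hx. unfold dsinc.
      destruct (Req_dec_T x 0); [lra|reflexivity].
    + apply (ex_derive_continuous (K := R_AbsRing) (V := R_NormedModule)).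
      auto_derive. simpl. nra.
Qed.

Lemma sinc_pos (v : R) : - PI < v < PI -> 0 < sinc v.
Proof.
  enough (P : forall v, 0 < v < PI -> 0 < sinc v).
  { intros Hv. destruct (Rtotal_order v 0) as [H|[->|H]].
    - rewrite <- sinc_opp. apply P. lra.
    - unfold sinc. destruct (Req_dec_T 0 0); lra.
    - apply P. lra. }
  intros u Hu. unfold sinc. destruct (Req_dec_T u 0); [lra|].
  apply Rdiv_lt_0_compat; [apply sin_gt_0|]; lra.
Qed.

(** [contour_re v = - v cot v], with the removable singularity at [0] filled in. *)
Definition contour_re (v : R) : R := - (cos v / sinc v).

(** The derivative of [contour_re], equal to [(v - sin v cos v) / sin^2 v] for
    [v <> 0]; in terms of [sinc] it is visibly continuous at [0]. *)
Definition contour_dre (v : R) : R := v + cos v * dsinc v / sinc v ^ 2.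

Definition contour (v : R) : C := (contour_re v, v).

Lemma contour_re_opp (v : R) : contour_re (- v) = contour_re v.
Proof. unfold contour_re. now rewrite sinc_opp, cos_neg. Qed.

Lemma contour_dre_opp (v : R) : contour_dre (- v) = - contour_dre v.
Proof. unfold contour_dre. rewrite sinc_opp, dsinc_opp, cos_neg. unfold Rdiv. ring. Qed.

Lemma is_derive_contour_re (v : R) : - PI < v < PI ->
  is_derive contour_re v (contour_dre v).
Proof.
  intros Hv. assert (Hs := sinc_pos v Hv).
  unfold contour_re. auto_derive.
  - split; [|lra]. exists (dsinc v). apply is_derive_sinc.
  - replace (Derive (fun x => sinc x) v) with (dsinc v)
      by (symmetry; apply is_derive_unique, is_derive_sinc).
    unfold contour_dre. rewrite <- sinc_spec at 1. field. lra.
Qed.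

Lemma continuous_sinc (v : R) : continuous sinc v.
Proof.
  apply (ex_derive_continuous (K := R_AbsRing) (V := R_NormedModule)).
  exists (dsinc v). apply is_derive_sinc.
Qed.

Lemma continuous_contour_re (v : R) : - PI < v < PI -> continuous contour_re v.
Proof.
  intros H. apply (ex_derive_continuous (K := R_AbsRing) (V := R_NormedModule)).
  eexists. apply is_derive_contour_re, H.
Qed.

Lemma continuous_contour_dre (v : R) : - PI < v < PI -> continuous contour_dre v.
Proof.
  intros Hv. assert (Hs := sinc_pos v Hv). unfold contour_dre, Rdiv.
  apply continuous_Rplus; [apply continuous_id|].
  apply continuous_Rmult.
  - apply continuous_Rmult; [|apply continuous_dsinc]. apply continuous_cos.
  - apply (continuous_comp (fun x => sinc x ^ 2) Rinv).
    + simpl. apply continuous_Rmult; [apply continuous_sinc|].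
      apply continuous_Rmult; [apply continuous_sinc|apply continuous_const].
    + apply continuous_Rinv. apply Rgt_not_eq, pow_lt, Hs.
Qed.

Lemma contour_dre_nonneg (v : R) : 0 <= v < PI -> 0 <= contour_dre v.
Proof.
  intros Hv. unfold contour_dre. destruct (Req_dec_T v 0) as [->|Hne].
  { unfold dsinc. destruct (Req_dec_T 0 0); [|lra]. unfold Rdiv. lra. }
  assert (Hs : 0 < sin v) by (apply sin_gt_0; lra).
  assert (Hs1 : sin v <= v).
  { assert (K := Rabs_sin_le v). rewrite !Rabs_pos_eq in K; lra. }
  assert (Hc := COS_bound v). assert (T := sin2_cos2 v). unfold Rsqr in T.
  unfold sinc, dsinc. destruct (Req_dec_T v 0); [lra|].
  replace (v + cos v * ((v * cos v - sin v) / v ^ 2) / (sin v / v) ^ 2)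
    with ((v * (sin v * sin v + cos v * cos v) - sin v * cos v) / sin v ^ 2) by (field; lra).
  rewrite T. apply Rdiv_le_0_compat; [nra|apply pow_lt, Hs].
Qed.

Lemma contour_re_monotone (u v : R) : Rabs u <= v < PI -> contour_re u <= contour_re v.
Proof.
  intros [Huv Hv].
  replace (contour_re u) with (contour_re (Rabs u)).
  2:{ unfold Rabs. destruct (Rcase_abs u); [apply contour_re_opp|reflexivity]. }
  assert (H0 := Rabs_pos u). revert Huv H0. generalize (Rabs u). intros x Hx H0.
  destruct (MVT_gen contour_re x v contour_dre) as [c [Hc E]];
    rewrite ?Rmin_left, ?Rmax_right in * by lra.
  - intros t Ht. apply is_derive_contour_re. lra.
  - intros t Ht. apply continuity_pt_filterlim, continuous_contour_re. lra.
  - assert (D : 0 <= contour_dre c) by (apply contour_dre_nonneg; lra). nra.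
Qed.

Lemma contour_re_ge (v : R) : - PI < v < PI -> - 1 <= contour_re v.
Proof.
  intros Hv. replace (-1) with (contour_re 0).
  - replace (contour_re v) with (contour_re (Rabs v)).
    2:{ unfold Rabs. destruct (Rcase_abs v); [apply contour_re_opp|reflexivity]. }
    apply contour_re_monotone. rewrite Rabs_R0.
    split; [apply Rabs_pos|]. apply Rabs_def1; lra.
  - unfold contour_re, sinc. destruct (Req_dec_T 0 0); [|lra]. rewrite cos_0. field.
Qed.

Lemma contour_re_unbounded (K : R) :
  exists a0, 0 < a0 < PI /\ forall a, a0 <= a < PI -> K <= contour_re a.
Proof.
  assert (HPI := PI_RGT_0). assert (H3 := PI2_3_2).
  (* At [a = PI - s]: [- a cos a = a cos s >= a / 2 >= 1], while [sin a = sin s <= s]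
     and [K s <= 1]. *)
  set (s := Rmin (PI / 3) (/ (Rabs K + 1))).
  assert (HK := Rabs_pos K). assert (HK2 := Rle_abs K).
  assert (Hs : 0 < s).
  { apply Rmin_glb_lt; [lra|apply Rinv_0_lt_compat; lra]. }
  assert (Hs1 : s <= PI / 3) by apply Rmin_l.
  assert (Hs2 : s <= / (Rabs K + 1)) by apply Rmin_r.
  exists (PI - s). split; [lra|]. intros a Ha.
  apply Rle_trans with (contour_re (PI - s)).
  2:{ apply contour_re_monotone. rewrite Rabs_pos_eq; lra. }
  unfold contour_re, sinc. destruct (Req_dec_T (PI - s) 0); [lra|].
  rewrite Rtrigo_facts.cos_pi_minus, Rtrigo_facts.sin_pi_minus.
  assert (Hsin : 0 < sin s) by (apply sin_gt_0; lra).
  assert (Hsin1 : sin s <= s).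
  { assert (J := Rabs_sin_le s). rewrite !Rabs_pos_eq in J; lra. }
  assert (Hcos : 1 / 2 <= cos s).
  { rewrite <- cos_PI3. apply cos_decr_1; lra. }
  replace (- (- cos s / (sin s / (PI - s)))) with ((PI - s) * cos s / sin s) by (field; lra).
  assert (H1 : s * (Rabs K + 1) <= 1).
  { apply (Rmult_le_compat_r (Rabs K + 1)) in Hs2; [|lra].
    rewrite Rinv_l in Hs2 by lra. exact Hs2. }
  apply (Rmult_le_reg_r (sin s)); [exact Hsin|].
  unfold Rdiv. rewrite (Rmult_assoc _ (/ sin s)), Rinv_l, Rmult_1_r by lra.
  assert (K * sin s <= 1 * 1) by nra. nra.
Qed.

(** * The weight of the integral representation *)

(** The reciprocal [(sin v / v) e^(v cot v)] of [v csc v e^(- v cot v)]. Unlike the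
    latter it extends continuously to [PI], so that all integrands in [v] become
    continuous functions on a closed interval. *)
Definition weight (v : R) : R :=
  if Rlt_dec v PI then sinc v * exp (- contour_re v) else 0.

Lemma weight_eq (v : R) : v < PI -> weight v = sinc v * exp (- contour_re v).
Proof. intros H. unfold weight. destruct (Rlt_dec v PI); [reflexivity|lra]. Qed.

Lemma weight_pos (v : R) : 0 <= v < PI -> 0 < weight v.
Proof.
  intros H. rewrite weight_eq by apply H.
  apply Rmult_lt_0_compat; [apply sinc_pos; lra|apply exp_pos].
Qed.

Lemma weight_nonneg (v : R) : 0 <= v -> 0 <= weight v.
Proof.
  intros H. destruct (Rlt_dec v PI).
  - apply Rlt_le, weight_pos. lra.
  - unfold weight. destruct (Rlt_dec v PI); lra.
Qed.

Lemma sinc_le_1 (v : R) : 0 <= v -> sinc v <= 1.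
Proof.
  intros H. unfold sinc. destruct (Req_dec_T v 0); [lra|].
  apply (Rmult_le_reg_r v); [lra|]. unfold Rdiv. rewrite Rmult_assoc, Rinv_l by assumption.
  assert (K := Rabs_sin_le v). rewrite (Rabs_pos_eq v) in K by assumption.
  assert (L := Rle_abs (sin v)). lra.
Qed.

Lemma weight_le (v : R) : 0 <= v -> weight v <= exp 1.
Proof.
  intros H. assert (He := exp_pos 1).
  unfold weight. destruct (Rlt_dec v PI) as [Hv|]; [|lra].
  assert (H1 := sinc_le_1 v H). assert (H2 := contour_re_ge v ltac:(lra)).
  assert (H3 := sinc_pos v ltac:(lra)).
  assert (H4 : exp (- contour_re v) <= exp 1).
  { destruct (Rle_lt_or_eq_dec (- contour_re v) 1) as [L|L]; [lra| |].
    - apply Rlt_le, exp_increasing, L.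
    - rewrite L. lra. }
  assert (H5 := exp_pos (- contour_re v)). nra.
Qed.

Lemma continuous_weight (v : R) : 0 <= v <= PI -> continuous weight v.
Proof.
  intros [H0 H1]. assert (HPI := PI_RGT_0). assert (H3 := PI2_3_2).
  destruct (Rlt_dec v PI) as [H|H].
  - apply (continuous_ext_loc _ (fun v => sinc v * exp (- contour_re v))).
    + assert (P : 0 < PI - v) by lra. exists (mkposreal _ P). intros y Hy.
      change (Rabs (y - v) < PI - v) in Hy. apply Rabs_def2 in Hy.
      symmetry. apply weight_eq. lra.
    + apply continuous_Rmult; [apply continuous_sinc|].
      apply (continuous_comp (fun v => - contour_re v) exp).
      * apply (continuous_opp (V := R_NormedModule)). apply continuous_contour_re. lra.
      * apply continuous_exp.
  - replace v with PI by lra. apply filterlim_locally. intros eps.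
    assert (P : 0 < Rmin eps 1) by (apply Rmin_glb_lt; [apply cond_pos|lra]).
    exists (mkposreal _ P). intros y Hy.
    change (Rabs (y - PI) < Rmin eps 1) in Hy.
    change (Rabs (weight y - weight PI) < eps).
    assert (Hy1 := Rlt_le_trans _ _ _ Hy (Rmin_l _ _)).
    assert (Hy2 := Rlt_le_trans _ _ _ Hy (Rmin_r _ _)).
    unfold weight. destruct (Rlt_dec PI PI); [lra|]. rewrite Rminus_0_r.
    destruct (Rlt_dec y PI) as [L|L]; [|rewrite Rabs_R0; apply cond_pos].
    rewrite Rabs_left in Hy1, Hy2 by lra.
    assert (S0 := sinc_pos y ltac:(lra)).
    rewrite Rabs_pos_eq by (apply Rmult_le_pos; [lra|apply Rlt_le, exp_pos]).
    assert (Q : 0 <= contour_re y).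
    { unfold contour_re. assert (cos y <= 0) by (apply cos_le_0; lra).
      assert (0 < / sinc y) by (apply Rinv_0_lt_compat, S0). unfold Rdiv. nra. }
    assert (E : exp (- contour_re y) <= 1).
    { rewrite <- exp_0. destruct Q as [Q|Q]; [left; apply exp_increasing; lra|].
      rewrite <- Q, Ropp_0. lra. }
    assert (S1 : y * sinc y <= PI - y).
    { rewrite sinc_spec. rewrite <- (Rtrigo_facts.sin_pi_minus y).
      assert (J := Rabs_sin_le (PI - y)). assert (J2 := Rle_abs (sin (PI - y))).
      rewrite (Rabs_pos_eq (PI - y)) in J by lra. lra. }
    assert (E2 := exp_pos (- contour_re y)). nra.
Qed.

Lemma inv_weight (v : R) : 0 < v < PI -> v * csc v * exp (- (v * cot v)) = / weight v.
Proof.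
  intros Hv. assert (Hs : 0 < sin v) by (apply sin_gt_0; lra).
  rewrite weight_eq by lra. unfold csc, cot, contour_re, sinc.
  destruct (Req_dec_T v 0); [lra|].
  replace (- - (cos v / (sin v / v))) with (v * (cos v / sin v)) by (field; lra).
  rewrite exp_Ropp. field. repeat split; try lra. apply Rgt_not_eq, exp_pos.
Qed.

Lemma contour_Cexp (v : R) : - PI < v < PI ->
  (contour v * Cexp (contour v))%C = RtoC (- / (sinc v * exp (- contour_re v))).
Proof.
  intros Hv. assert (Hs := sinc_pos v Hv). assert (T := sin2_cos2 v). unfold Rsqr in T.
  assert (S := sinc_spec v).
  rewrite exp_Ropp. assert (He := exp_pos (contour_re v)).
  unfold Cexp, contour; simpl. apply injective_projections; simpl.
  - replace (- / (sinc v * / exp (contour_re v)))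
      with (- (exp (contour_re v) * (sin v * sin v + cos v * cos v) / sinc v))
      by (rewrite T; field; split; lra).
    unfold contour_re at 1. rewrite <- S. field. lra.
  - unfold contour_re at 1. rewrite <- S. field. lra.
Qed.

(** This is the derivative along the contour of the real function
    [zeta e^zeta]. *)
Lemma contour_deriv_real (v : R) : - PI < v < PI ->
  snd ((1 + contour v) * Cexp (contour v) * (contour_dre v, 1%R))%C = 0.
Proof.
  intros Hv. assert (Hs := sinc_pos v Hv). assert (T := sin2_cos2 v). unfold Rsqr in T.
  assert (S := sinc_spec v). assert (D := dsinc_spec v).
  replace ((1 + contour v) * Cexp (contour v))%C
    with (Cexp (contour v) + contour v * Cexp (contour v))%C by ring.
  rewrite contour_Cexp by exact Hv. rewrite exp_Ropp.
  unfold Cexp, contour; simpl. assert (He := exp_pos (contour_re v)).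
  set (e := exp (contour_re v)) in *.
  (* with [v sinc v = sin v] and [v dsinc v = cos v - sinc v] *)
  assert (K : sin v * contour_dre v + cos v - / sinc v = 0).
  { unfold contour_dre.
    replace (sin v * (v + cos v * dsinc v / sinc v ^ 2) + cos v - / sinc v)
      with ((sin v * (v * sinc v) + cos v * (v * dsinc v) + cos v * sinc v - 1) / sinc v
            + cos v * dsinc v / sinc v ^ 2 * (sin v - v * sinc v)) by (field; lra).
    rewrite D, S.
    replace (sin v * sin v + cos v * (cos v - sinc v) + cos v * sinc v - 1)
      with (sin v * sin v + cos v * cos v - 1) by ring.
    rewrite T. field. lra. }
  replace (/ (sinc v * / e)) with (e * / sinc v) by (field; split; lra).
  transitivity (e * (sin v * contour_dre v + cos v - / sinc v)); [ring|]. rewrite K. ring.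
Qed.

(** * The resolvent integral along the contour *)

(** The part of the range of the principal branch lying over the closed right
    half-plane, without the origin. *)
Definition right_branch (w : C) : Prop :=
  0 < fst w /\ Rabs (snd w) < PI / 2 /\ 0 <= fst (w * Cexp w)%C.

Lemma mult_Cexp_diff (w u : C) :
  (w * Cexp w - u * Cexp u = (w - u) * Cexp u * (1 + w * expdiff (w - u)))%C.
Proof.
  assert (E : Cexp w = (Cexp u * (1 + (w - u) * expdiff (w - u)))%C).
  { rewrite expdiff_spec. replace (1 + (Cexp (w - u) - 1))%C with (Cexp (w - u)) by ring.
    rewrite <- Cexp_plus. f_equal. ring. }
  rewrite E. ring.
Qed.

(** A zero would give [u e^u = w e^w] with [u <> w]. Comparing the signs of the
    real and imaginary parts forces [Im u] to lie within [PI / 2] of [Im w];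
    there [expdiff (w - u)] and [1 / w] both have positive real part. *)
Lemma expdiff_denom_neq_0 (w u : C) :
  right_branch w -> - PI < snd u < PI -> contour_re (snd u) <= fst u ->
  (1 + w * expdiff (w - u) <> 0)%C.
Proof.
  intros [Hx [Hy Hz]] Hb Ha H.
  assert (HPI := PI_RGT_0).
  assert (E := mult_Cexp_diff w u). rewrite H in E.
  replace ((w - u) * Cexp u * 0)%C with (RtoC 0) in E by ring.
  assert (Hclose : Rabs (snd w - snd u) <= PI / 2).
  { destruct w as [x y], u as [a b]. unfold Cexp in *; simpl in *.
    injection E as E1 E2.
    assert (Hea := exp_pos a). assert (Hex := exp_pos x).
    apply Rabs_def2 in Hy.
    assert (Re : 0 <= a * cos b - b * sin b) by nra.
    assert (Im : exp x * (x * sin y + y * cos y) = exp a * (a * sin b + b * cos b)) by lra.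
    assert (Hcy : 0 < cos y) by (apply cos_gt_0; lra).
    assert (Far : forall b, PI / 2 <= b < PI -> contour_re b <= a ->
        a * cos b - b * sin b < 0).
    { intros c Hc Hac. assert (Hsc : 0 < sin c) by (apply sin_gt_0; lra).
      assert (Hcc : cos c <= 0) by (apply cos_le_0; lra).
      assert (Hq : 0 <= contour_re c).
      { unfold contour_re. assert (P := Rinv_0_lt_compat _ (sinc_pos c ltac:(lra))).
        unfold Rdiv. nra. }
      assert (0 < c * sin c) by (apply Rmult_lt_0_compat; lra). nra. }
    assert (Hb2 : - (PI / 2) < b < PI / 2).
    { split; apply Rnot_le_lt; intros L.
      - specialize (Far (- b)). rewrite contour_re_opp, cos_neg, sin_neg in Far.
        specialize (Far ltac:(lra) Ha). lra.
      - specialize (Far b ltac:(lra) Ha). lra. }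
    assert (Hcb : 0 < cos b) by (apply cos_gt_0; lra).
    (* to the right of the contour, [Im (u e^u)] has the sign of [Im u] *)
    assert (Sgn : 0 <= b * (a * sin b + b * cos b)).
    { assert (S := sinc_spec b). assert (P := sinc_pos b ltac:(lra)).
      unfold contour_re in Ha.
      assert (Q : 0 <= a * sinc b + cos b).
      { replace (a * sinc b + cos b) with ((a - - (cos b / sinc b)) * sinc b) by (field; lra).
        apply Rmult_le_pos; lra. }
      replace (a * sin b + b * cos b) with (b * (a * sinc b + cos b)) by (rewrite <- S; ring).
      nra. }
    destruct (Rtotal_order y 0) as [Ly|[Ly|Ly]].
    - assert (sin y < 0) by (apply sin_lt_0_var; lra).
      assert (x * sin y + y * cos y < 0) by nra.
      assert (a * sin b + b * cos b < 0) by nra.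
      assert (b <= 0) by nra. apply Rabs_le. lra.
    - rewrite Ly. apply Rabs_le. lra.
    - assert (0 < sin y) by (apply sin_gt_0; lra).
      assert (0 < x * sin y + y * cos y) by nra.
      assert (0 < a * sin b + b * cos b) by nra.
      assert (0 <= b) by nra. apply Rabs_le. lra. }
  assert (P : 0 < fst (expdiff (w - u))) by (apply expdiff_re_pos; exact Hclose).
  destruct w as [x y], (expdiff ((x, y) - u)) as [p q]. simpl in *.
  injection H as H1 H2.
  assert (0 < p * (x * x + y * y)) by (apply Rmult_lt_0_compat; nra).
  assert (p * (x * x + y * y) = x * (x * p - y * q) + y * (x * q + y * p)) by ring.
  replace (x * q + y * p) with 0 in * by lra. replace (x * p - y * q) with (-1) in * by lra.
  lra.
Qed.

(** This is [(e^w - e^u) / (w e^w - u e^u)] with the common factor [w - u]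
    cancelled; adding [1] gives
    [((1 + w) e^w - (1 + u) e^u) / (w e^w - u e^u)]. *)
Definition regularized (w u : C) : C :=
  (expdiff (w - u) / (1 + w * expdiff (w - u)))%C.

Lemma ex_Cderive_regularized (w u : C) :
  (1 + w * expdiff (w - u) <> 0)%C -> exists l, Cderive (regularized w) u l.
Proof.
  intros H. destruct (ex_Cderive_expdiff (w - u)) as [k Hk].
  assert (H0 : Cderive (fun u => w - u)%C u (- (1))%C).
  { apply (Cderive_quadratic _ _ _ 1 0); [lra|]. intros p _.
    replace (w - p - (w - u) - - (1) * (p - u))%C with (RtoC 0) by ring.
    rewrite Cmod_0. lra. }
  assert (H1 := Cderive_comp expdiff (fun u => w - u)%C u k _ Hk H0).
  eexists. unfold regularized, Cdiv.
  apply Cderive_mult; [exact H1|].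
  apply (Cderive_comp Cinv (fun u => 1 + w * expdiff (w - u))%C); [apply Cderive_inv, H|].
  apply Cderive_plus; [apply Cderive_const|].
  apply Cderive_mult; [apply Cderive_const|exact H1].
Qed.

Lemma regularized_mult (w u : C) : (1 + w * expdiff (w - u) <> 0)%C ->
  (regularized w u * (w * Cexp w - u * Cexp u) = Cexp w - Cexp u)%C.
Proof.
  intros H. rewrite mult_Cexp_diff.
  replace (Cexp w) with (Cexp u * Cexp (w - u))%C by (rewrite <- Cexp_plus; f_equal; ring).
  replace (Cexp (w - u)) with (1 + (w - u) * expdiff (w - u))%C
    by (rewrite expdiff_spec; ring).
  unfold regularized. field. exact H.
Qed.

(** Far to the right the quotient [(e^w - e^u) / (w e^w - u e^u)] behaves like
    [1 / u]. *)
Lemma regularized_bound (w u : C) : right_branch w -> - PI < snd u < PI ->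
  contour_re (snd u) <= fst u ->
  0 < fst u -> fst w <= fst u -> 2 * Cmod (w * Cexp w) <= fst u ->
  Cmod (regularized w u) <= 4 / fst u.
Proof.
  intros Hw Hb Ha H0 H1 H2.
  assert (E := regularized_mult w u (expdiff_denom_neq_0 w u Hw Hb Ha)).
  assert (E' := f_equal Cmod E). rewrite Cmod_mult in E'.
  set (A := fst u) in *.
  assert (He : 1 <= exp A) by (assert (K := exp_ineq1_le A); lra).
  assert (N : Cmod (Cexp w - Cexp u) <= 2 * exp A).
  { replace (Cexp w - Cexp u)%C with (Cexp w + - Cexp u)%C by ring.
    eapply Rle_trans; [apply Cmod_triangle|]. rewrite Cmod_opp, !Cmod_Cexp. fold A.
    assert (exp (fst w) <= exp A); [|lra].
    destruct H1 as [H1|H1]; [left; apply exp_increasing, H1|rewrite H1; lra]. }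
  assert (D : A * exp A / 2 <= Cmod (w * Cexp w - u * Cexp u)).
  { assert (T := Cmod_triangle (w * Cexp w - u * Cexp u) (- (w * Cexp w))).
    replace (w * Cexp w - u * Cexp u + - (w * Cexp w))%C with (- (u * Cexp u))%C in T by ring.
    rewrite !Cmod_opp, (Cmod_mult u), (Cmod_Cexp u) in T. fold A in T.
    assert (A <= Cmod u).
    { eapply Rle_trans; [apply Rle_abs|apply fst_le_Cmod]. }
    assert (A * exp A <= Cmod u * exp A) by (apply Rmult_le_compat_r; lra).
    assert (A <= A * exp A) by nra. lra. }
  assert (P := Cmod_ge_0 (regularized w u)).
  apply (Rmult_le_reg_r (A * exp A / 2)); [nra|].
  replace (4 / A * (A * exp A / 2)) with (2 * exp A) by (field; lra).
  eapply Rle_trans; [|exact N]. rewrite <- E'. apply Rmult_le_compat_l; assumption.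
Qed.

Lemma contour_dre_bounded (a : R) : 0 <= a < PI ->
  exists M, forall v, - a <= v <= a -> Rabs (contour_dre v) <= M.
Proof.
  intros Ha.
  destruct (continuity_ab_maj (fun v => Rabs (contour_dre v)) (- a) a) as [m [Hm _]].
  - lra.
  - intros c Hc. apply continuity_pt_filterlim.
    apply (continuous_comp contour_dre Rabs); [|apply continuous_Rabs].
    apply continuous_contour_dre. lra.
  - exists (Rabs (contour_dre m)). exact Hm.
Qed.

(** The contour is pushed horizontally onto the vertical segment through its two
    end points, so that only these two curves bound the deformation. *)
Lemma regularized_deform (w : C) (a : R) : right_branch w -> 0 < a < PI ->
  ex_CInt (fun v => regularized w (contour v) * (contour_dre v, 1%R))%C (- a) a /\
  ex_CInt (fun v => regularized w (contour_re a, v) * (0, 1))%C (- a) a /\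
  CInt (fun v => regularized w (contour v) * (contour_dre v, 1%R))%C (- a) a =
  CInt (fun v => regularized w (contour_re a, v) * (0, 1))%C (- a) a.
Proof.
  intros Hw Ha. destruct (contour_dre_bounded a ltac:(lra)) as [M HM].
  set (A := contour_re a).
  assert (HA : forall v, - a <= v <= a -> -1 <= contour_re v <= A).
  { intros v Hv. split; [apply contour_re_ge; lra|].
    apply contour_re_monotone. split; [|lra]. apply Rabs_le. lra. }
  set (g := fun r v => ((1 - r) * contour_re v + r * A, v) : C).
  set (gr := fun r v : R => (A - contour_re v, 0) : C).
  set (gv := fun r v => ((1 - r) * contour_dre v, 1) : C).
  assert (H : holomorphic_rect (regularized w) g gr gv 0 1 (- a) a (A + 1 + (M + 1))).
  { assert (HM0 : 0 <= M) by (eapply Rle_trans; [apply Rabs_pos|apply (HM 0); lra]).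
    assert (HA0 := HA 0 ltac:(lra)).
    split; intros r v Hr Hv; assert (HAv := HA v Hv).
    - apply Rderive_pair; simpl.
      + auto_derive; [exact I|]. ring.
      + apply (is_derive_const (V := R_NormedModule)).
    - apply Rderive_pair; simpl.
      + auto_derive.
        * eexists. apply is_derive_contour_re. lra.
        * replace (Derive (fun x => contour_re x) v) with (contour_dre v); [ring|].
          symmetry. apply is_derive_unique, is_derive_contour_re. lra.
      + apply (is_derive_id (K := R_AbsRing)).
    - apply continuous_const.
    - apply continuous_pair; simpl; [|apply continuous_const].
      apply continuous_Rmult; [apply continuous_const|apply continuous_contour_dre; lra].
    - eapply Rle_trans; [apply Cmod_le_comp|]. simpl.
      rewrite Rabs_R0, Rabs_pos_eq by lra. lra.
    - eapply Rle_trans; [apply Cmod_le_comp|]. simpl.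
      rewrite Rabs_R1, Rabs_mult, (Rabs_pos_eq (1 - r)) by lra.
      specialize (HM v Hv). assert (P := Rabs_pos (contour_dre v)). nra.
    - apply ex_Cderive_regularized, expdiff_denom_neq_0; [exact Hw| |]; simpl; [lra|]. nra. }
  destruct (rect_ex_CInt _ _ _ _ _ _ _ _ _ H) as [_ E].
  assert (E0 := E 0 (- a) a ltac:(lra) ltac:(lra) ltac:(lra) ltac:(lra)).
  assert (E1 := E 1 (- a) a ltac:(lra) ltac:(lra) ltac:(lra) ltac:(lra)).
  assert (X0 : forall v, (regularized w (g 0 v) * gv 0 v =
     regularized w (contour v) * (contour_dre v, 1%R))%C).
  { intros v. unfold g, gv, contour.
    replace ((1 - 0) * contour_re v + 0 * A) with (contour_re v) by ring.
    replace ((1 - 0) * contour_dre v) with (contour_dre v) by ring. reflexivity. }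
  assert (X1 : forall v, (regularized w (g 1 v) * gv 1 v = regularized w (A, v) * (0, 1))%C).
  { intros v. unfold g, gv.
    replace ((1 - 1) * contour_re v + 1 * A) with A by ring.
    replace ((1 - 1) * contour_dre v) with 0 by ring. reflexivity. }
  split; [exact (ex_RInt_ext (V := C_R_NormedModule) _ _ _ _ (fun v _ => X0 v) E0)|].
  split; [exact (ex_RInt_ext (V := C_R_NormedModule) _ _ _ _ (fun v _ => X1 v) E1)|].
  assert (B := cauchy_goursat (regularized w) g gr gv 0 1 (- a) a _
    ltac:(lra) ltac:(lra) H).
  unfold boundary_integral in B.
  rewrite (CInt_ext (fun v => regularized w (g 0 v) * gv 0 v)%C _ _ _ (fun v _ => X0 v)) in B.
  rewrite (CInt_ext (fun v => regularized w (g 1 v) * gv 1 v)%C _ _ _ (fun v _ => X1 v)) in B.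
  assert (Z : forall v, contour_re v = A ->
    CInt (fun r => regularized w (g r v) * gr r v)%C 0 1 = RtoC 0).
  { intros v Hv. apply is_CInt_unique.
    assert (I0 := is_CInt_const 0 1 0). rewrite Cmult_0_r in I0.
    refine (is_RInt_ext (V := C_R_NormedModule) _ _ _ _ _ _ I0).
    intros r _. unfold gr. rewrite Hv, Rminus_diag. symmetry. apply Cmult_0_r. }
  rewrite (Z (- a)), (Z a) in B by (unfold A; auto using contour_re_opp).
  match type of B with (_ + ?p - _ - ?q)%C = _ => set (P := p) in *; set (Q := q) in * end.
  transitivity (P - (0 + P - 0 - Q))%C; [ring|]. rewrite B. ring.
Qed.

Lemma Cexp_conj (u : C) : Cexp (Cconj u) = Cconj (Cexp u).
Proof.
  destruct u as [a b]. unfold Cexp, Cconj; simpl. rewrite cos_neg, sin_neg.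
  apply injective_projections; simpl; ring.
Qed.

Lemma contour_opp (v : R) : contour (- v) = Cconj (contour v).
Proof. unfold contour, Cconj; simpl. now rewrite contour_re_opp. Qed.

(** The function [1 / (z + 1 / weight v)], in a form that makes sense where
    [weight] vanishes. *)
Definition resolvent (z : C) (v : R) : C := (RtoC (weight v) / (1 + z * RtoC (weight v)))%C.

Lemma resolvent_denom (z : C) (v : R) : 0 <= fst z -> 0 <= v ->
  1 <= Cmod (1 + z * RtoC (weight v)).
Proof.
  intros Hz Hv. assert (Hw := weight_nonneg v Hv).
  eapply Rle_trans; [|apply fst_le_Cmod]. simpl.
  eapply Rle_trans; [|apply Rle_abs]. nra.
Qed.

Lemma resolvent_bound (z : C) (v : R) : 0 <= fst z -> 0 <= v ->
  Cmod (resolvent z v) <= exp 1.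
Proof.
  intros Hz Hv. assert (Hd := resolvent_denom z v Hz Hv).
  unfold resolvent. rewrite Cmod_div by (apply Cmod_gt_0; lra).
  rewrite Cmod_R, Rabs_pos_eq by (apply weight_nonneg, Hv).
  assert (H1 := weight_le v Hv). assert (H2 := weight_nonneg v Hv).
  apply (Rmult_le_reg_r (Cmod (1 + z * RtoC (weight v)))); [lra|].
  unfold Rdiv. rewrite Rmult_assoc, Rinv_l, Rmult_1_r by lra. nra.
Qed.

Lemma continuous_resolvent (z : C) (v : R) : 0 <= fst z -> 0 <= v <= PI ->
  continuous (resolvent z) v.
Proof.
  intros Hz Hv. assert (Hd := resolvent_denom z v Hz (proj1 Hv)).
  assert (W : continuous (fun v => RtoC (weight v)) v)
    by (apply continuous_RtoC, continuous_weight, Hv).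
  apply continuous_Cmult; [exact W|].
  apply (continuous_comp (fun v => 1 + z * RtoC (weight v))%C Cinv).
  - apply continuous_Cplus; [apply continuous_const|].
    apply continuous_Cmult; [apply continuous_const|exact W].
  - eapply Cderive_continuous, Cderive_inv. apply Cmod_gt_0. lra.
Qed.

(** The reflection [v -> - v] conjugates the contour and leaves [u e^u] fixed. In
    the sum the real odd term [(1 + u) e^u du] cancels, and [du] leaves [2 i]. *)
Lemma regularized_contour_even (w : C) (v : R) : right_branch w -> 0 <= v < PI ->
  (regularized w (contour v) * (contour_dre v, 1%R)
   + regularized w (contour (- v)) * (contour_dre (- v), 1%R)
   = 2 * Ci * ((1 + w) * Cexp w * resolvent (w * Cexp w) v - 1))%C.
Proof.
  intros Hw Hv.
  set (z := (w * Cexp w)%C). set (u := contour v). set (du := (contour_dre v, 1) : C).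
  assert (Hwt := weight_pos v Hv).
  assert (Hd := resolvent_denom z v (proj2 (proj2 Hw)) (proj1 Hv)).
  assert (Hd0 : (1 + z * RtoC (weight v) <> 0)%C) by (apply Cmod_gt_0; lra).
  assert (Hwt0 : RtoC (weight v) <> 0) by (intros K; apply RtoC_inj in K; lra).
  assert (Hu : (u * Cexp u = - / RtoC (weight v))%C).
  { unfold u. rewrite contour_Cexp by lra. rewrite weight_eq in * by lra.
    rewrite RtoC_opp, RtoC_inv by lra. reflexivity. }
  assert (Hub : (Cconj u * Cexp (Cconj u) = - / RtoC (weight v))%C).
  { rewrite Cexp_conj. unfold u, contour. transitivity (Cconj (u * Cexp u)).
    - unfold u, contour. destruct (Cexp (contour_re v, v)) as [p q].
      unfold Cconj; simpl. apply injective_projections; simpl; ring.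
    - rewrite Hu, <- RtoC_inv, <- RtoC_opp by lra. unfold Cconj; simpl.
      now rewrite Ropp_0. }
  assert (S : forall c, - PI < snd c < PI -> contour_re (snd c) <= fst c ->
     (c * Cexp c = - / RtoC (weight v))%C ->
     regularized w c = (((1 + w) * Cexp w - (1 + c) * Cexp c) * resolvent z v - 1)%C).
  { intros c Hc1 Hc2 Hc.
    assert (E := regularized_mult w c (expdiff_denom_neq_0 w c Hw Hc1 Hc2)).
    rewrite Hc in E. fold z in E.
    replace ((1 + w) * Cexp w - (1 + c) * Cexp c)%C
      with ((Cexp w - Cexp c) + z - c * Cexp c)%C by (unfold z; ring).
    rewrite <- E, Hc. unfold resolvent. field. split; assumption. }
  rewrite contour_opp, contour_dre_opp. fold u.
  rewrite (S u), (S (Cconj u)); trivial; unfold u, contour; simpl; try lra.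
  2:{ rewrite contour_re_opp. lra. }
  fold (contour v). fold u.
  set (r := resolvent z v).
  (* [(1 + u) e^u du] is real, hence changes sign under [v -> -v] *)
  assert (B : ((1 + u) * Cexp u * du
      + (1 + Cconj u) * Cexp (Cconj u) * ((- contour_dre v)%R, 1%R) = 0)%C).
  { assert (R0 := contour_deriv_real v ltac:(lra)). fold u in R0. fold du in R0.
    replace ((- contour_dre v)%R, 1%R) with (- Cconj du)%C
      by (unfold du, Cconj; apply injective_projections; simpl; ring).
    rewrite Cexp_conj.
    transitivity ((1 + u) * Cexp u * du - Cconj ((1 + u) * Cexp u * du))%C.
    - destruct (Cexp u) as [p q], u as [s t], du as [m n]. unfold Cconj; simpl.
      apply injective_projections; simpl; ring.
    - set (b := ((1 + u) * Cexp u * du)%C) in *. destruct b as [p q]. simpl in R0.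
      subst q. unfold Cconj; apply injective_projections; simpl; ring. }
  assert (D : (du + ((- contour_dre v)%R, 1%R) = 2 * Ci)%C).
  { unfold du, Ci; apply injective_projections; simpl; ring. }
  change (Cconj (contour_re v, v)) with (Cconj u).
  transitivity (((1 + w) * Cexp w * r - 1) * (du + ((- contour_dre v)%R, 1%R))
    - r * ((1 + u) * Cexp u * du
      + (1 + Cconj u) * Cexp (Cconj u) * ((- contour_dre v)%R, 1%R)))%C; [ring|].
  rewrite B, D. ring.
Qed.

Lemma CInt_symmetric (f : R -> C) (a : R) : 0 <= a -> ex_CInt f (- a) a ->
  is_CInt (fun v => f v + f (- v)%R)%C 0 a (CInt f (- a) a).
Proof.
  intros Ha H.
  assert (H1 : ex_CInt f (- a) 0).
  { apply (ex_RInt_Chasles_1 (V := C_R_CompleteNormedModule) f _ 0 a); [lra|exact H]. }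
  assert (H2 : ex_CInt f 0 a).
  { apply (ex_RInt_Chasles_2 (V := C_R_CompleteNormedModule) f (- a) 0 a); [lra|exact H]. }
  rewrite <- (CInt_Chasles f (- a) 0 a H1 H2), Cplus_comm.
  apply is_CInt_plus; [apply CInt_correct, H2|].
  apply CInt_correct in H1. apply (is_RInt_swap (V := C_R_NormedModule)) in H1.
  rewrite <- Ropp_0 in H1 at 1.
  apply (is_RInt_comp_opp (V := C_R_NormedModule)) in H1.
  apply (is_RInt_opp (V := C_R_NormedModule)) in H1.
  rewrite opp_opp in H1.
  eapply is_RInt_ext; [|exact H1]. intros x _. cbv beta. apply opp_opp.
Qed.

Lemma resolvent_partial (w : C) (a : R) : right_branch w -> 0 < a < PI ->
  fst w <= contour_re a -> 2 * Cmod (w * Cexp w) <= contour_re a ->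
  Cmod ((1 + w) * Cexp w * CInt (resolvent (w * Cexp w)) 0 a - RtoC a)
    <= 4 * a / contour_re a.
Proof.
  intros Hw Ha H1 H2. set (A := contour_re a) in *.
  assert (HA : 0 < A) by (destruct Hw; lra).
  destruct (regularized_deform w a Hw Ha) as [E0 [E1 E]]. fold A in E, E1.
  assert (S := CInt_symmetric _ a ltac:(lra) E0). rewrite E in S.
  assert (Hres : is_CInt (resolvent (w * Cexp w)) 0 a (CInt (resolvent (w * Cexp w)) 0 a)).
  { apply CInt_correct, ex_CInt_continuous; [lra|]. intros t Ht.
    apply continuous_resolvent; [apply Hw|lra]. }
  assert (Hone : is_CInt (fun _ => RtoC 1) 0 a (RtoC a)).
  { assert (I1 := is_CInt_const 0 a 1). rewrite Rminus_0_r, Cmult_1_r in I1. exact I1. }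
  assert (S' := is_CInt_mult_l (2 * Ci) _ _ _ _
    (is_CInt_minus _ _ _ _ _ _ (is_CInt_mult_l ((1 + w) * Cexp w) _ _ _ _ Hres) Hone)).
  assert (U : (2 * Ci * ((1 + w) * Cexp w * CInt (resolvent (w * Cexp w)) 0 a - RtoC a)
     = CInt (fun v => regularized w (A, v) * (0, 1)) (- a) a)%C).
  { rewrite <- (is_CInt_unique _ _ _ _ S). symmetry. apply is_CInt_unique.
    eapply is_RInt_ext; [|exact S'].
    rewrite Rmin_left, Rmax_right by lra. intros v Hv. cbv beta. symmetry.
    apply regularized_contour_even; [exact Hw|lra]. }
  assert (N : Cmod (CInt (fun v => regularized w (A, v) * (0, 1))%C (- a) a)
     <= (a - - a) * (4 / A)).
  { apply CInt_bound; [lra|exact E1|]. intros v Hv.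
    rewrite Cmod_mult. change ((0, 1) : C) with Ci. rewrite Cmod_Ci, Rmult_1_r.
    apply (regularized_bound w (A, v) Hw); simpl; trivial; try lra.
    apply contour_re_monotone. split; [apply Rabs_le; lra|lra]. }
  rewrite <- U, !Cmod_mult, Cmod_Ci, Cmod_R, Rabs_pos_eq in N by lra.
  replace ((a - - a) * (4 / A)) with (2 * (4 * a / A)) in N by (field; lra). lra.
Qed.

(** The limit [a -> PI] of [resolvent_partial], in which the end points of the
    contour go to infinity. *)
Lemma resolvent_integral (w : C) : right_branch w ->
  ((1 + w) * Cexp w * CInt (resolvent (w * Cexp w)) 0 PI = RtoC PI)%C.
Proof.
  intros Hw. assert (HPI := PI_RGT_0).
  set (z := (w * Cexp w)%C). set (K := Cmod ((1 + w) * Cexp w)).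
  assert (HK : 0 <= K) by apply Cmod_ge_0. assert (He := exp_pos 1).
  assert (Hex : forall p q, 0 <= p -> p <= q -> q <= PI -> ex_CInt (resolvent z) p q).
  { intros p q Hp Hpq Hq. apply ex_CInt_continuous; [exact Hpq|]. intros t Ht.
    apply continuous_resolvent; [apply Hw|lra]. }
  apply Ceq_minus. apply Cmod_eq_0. apply Rle_antisym; [|apply Cmod_ge_0].
  apply Rnot_lt_le. intros Hpos. set (m := Cmod _) in Hpos.
  destruct (contour_re_unbounded (Rmax (Rmax (fst w) (2 * Cmod z)) (1 + 16 * PI / m)))
    as [a0 [Ha0 Hlarge]].
  set (s := Rmin (PI - a0) (m / (4 * (K * exp 1 + 1)))).
  assert (HKe : 0 < K * exp 1 + 1) by nra.
  assert (Hs : 0 < s).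
  { apply Rmin_glb_lt; [lra|]. apply Rdiv_lt_0_compat; lra. }
  assert (Hs1 : s <= PI - a0) by apply Rmin_l.
  assert (Hs2 : s * (K * exp 1 + 1) <= m / 4).
  { assert (L : s <= m / (4 * (K * exp 1 + 1))) by apply Rmin_r.
    apply (Rmult_le_compat_r (K * exp 1 + 1)) in L; [|lra].
    replace (m / (4 * (K * exp 1 + 1)) * (K * exp 1 + 1)) with (m / 4) in L by (field; lra).
    exact L. }
  specialize (Hlarge (PI - s) ltac:(lra)). set (A := contour_re (PI - s)) in *.
  assert (L1 : fst w <= A).
  { eapply Rle_trans; [|exact Hlarge]. eapply Rle_trans; [|apply Rmax_l]. apply Rmax_l. }
  assert (L2 : 2 * Cmod z <= A).
  { eapply Rle_trans; [|exact Hlarge]. eapply Rle_trans; [|apply Rmax_l]. apply Rmax_r. }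
  assert (L3 : 1 + 16 * PI / m <= A) by (eapply Rle_trans; [apply Rmax_r|exact Hlarge]).
  assert (P := resolvent_partial w (PI - s) Hw ltac:(lra) L1 L2). fold z in P. fold A in P.
  assert (Tail : Cmod (CInt (resolvent z) (PI - s) PI) <= s * exp 1).
  { replace s with (PI - (PI - s)) at 2 by ring. apply CInt_bound; [lra|apply Hex; lra|].
    intros t Ht. apply resolvent_bound; [apply Hw|lra]. }
  assert (Small : 4 * (PI - s) / A <= m / 4).
  { assert (0 < 16 * PI / m) by (apply Rdiv_lt_0_compat; lra).
    apply (Rmult_le_reg_r A); [lra|]. unfold Rdiv at 1.
    rewrite Rmult_assoc, Rinv_l, Rmult_1_r by lra.
    apply Rle_trans with (m / 4 * (16 * PI / m)); [|apply Rmult_le_compat_l; lra].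
    replace (m / 4 * (16 * PI / m)) with (4 * PI) by (field; lra). lra. }
  assert (Total : m <= 4 * (PI - s) / A + K * (s * exp 1) + s).
  { unfold m. rewrite <- (CInt_Chasles (resolvent z) 0 (PI - s) PI) by (apply Hex; lra).
    set (I1 := CInt (resolvent z) 0 (PI - s)) in *.
    set (I2 := CInt (resolvent z) (PI - s) PI) in *.
    replace ((1 + w) * Cexp w * (I1 + I2) - RtoC PI)%C
      with (((1 + w) * Cexp w * I1 - RtoC (PI - s)) + (1 + w) * Cexp w * I2 + - RtoC s)%C
      by (rewrite RtoC_minus; ring).
    eapply Rle_trans; [apply Cmod_triangle|]. apply Rplus_le_compat.
    - eapply Rle_trans; [apply Cmod_triangle|]. apply Rplus_le_compat; [exact P|].
      rewrite Cmod_mult. apply Rmult_le_compat_l; [exact HK|exact Tail].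
    - rewrite Cmod_opp, Cmod_R, Rabs_pos_eq; lra. }
  nra.
Qed.

(** * The density as an integral of continuous functions *)

(** The integrand of [phi b], given at [PI] its limit [0], which makes it
    continuous there. *)
Definition decay (b v : R) : R :=
  if Rlt_dec v PI then exp (- (b / weight v)) else 0.

Lemma decay_eq (b v : R) : v < PI -> decay b v = exp (- (b / weight v)).
Proof. intros H. unfold decay. destruct (Rlt_dec v PI); [reflexivity|lra]. Qed.

Lemma exp_opp_le_inv (x : R) : 0 < x -> exp (- x) <= / x.
Proof.
  intros H. rewrite exp_Ropp. apply Rinv_le_contravar; [exact H|].
  assert (K := exp_ineq1_le x). lra.
Qed.

Lemma exp_monotone (x y : R) : x <= y -> exp x <= exp y.
Proof. intros [H| ->]; [left; apply exp_increasing, H|right; reflexivity]. Qed.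

Lemma decay_bounds (b v : R) : 0 <= b -> 0 <= v -> 0 <= decay b v <= exp (- (b / exp 1)).
Proof.
  intros Hb Hv. unfold decay. destruct (Rlt_dec v PI) as [L|L].
  - split; [apply Rlt_le, exp_pos|]. apply exp_monotone, Ropp_le_contravar.
    apply Rmult_le_compat_l; [exact Hb|]. apply Rinv_le_contravar.
    + apply weight_pos. lra.
    + apply weight_le, Hv.
  - split; [lra|apply Rlt_le, exp_pos].
Qed.

Lemma continuous_decay (b v : R) : 0 < b -> 0 <= v <= PI -> continuous (decay b) v.
Proof.
  intros Hb [H0 H1]. assert (HPI := PI_RGT_0).
  assert (Hc := continuous_weight v (conj H0 H1)).
  destruct (Rlt_dec v PI) as [H|H].
  - apply (continuous_ext_loc _ (fun v => exp (- (b * / weight v)))).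
    + assert (P : 0 < PI - v) by lra. exists (mkposreal _ P). intros y Hy.
      change (Rabs (y - v) < PI - v) in Hy. apply Rabs_def2 in Hy.
      symmetry. apply decay_eq. lra.
    + apply (continuous_comp (fun v => - (b * / weight v)) exp); [|apply continuous_exp].
      apply (continuous_opp (V := R_NormedModule)).
      apply continuous_Rmult; [apply continuous_const|].
      apply (continuous_comp weight Rinv); [exact Hc|].
      apply continuous_Rinv. apply Rgt_not_eq, weight_pos. lra.
  - replace v with PI in * by lra. apply filterlim_locally. intros eps.
    assert (P : 0 < b * eps) by (apply Rmult_lt_0_compat; [exact Hb|apply cond_pos]).
    assert (Q := proj1 (filterlim_locally weight (weight PI)) Hc (mkposreal _ P)).
    assert (S : locally PI (fun y => 0 < y)).
    { exists (mkposreal _ HPI). intros y Hy. change (Rabs (y - PI) < PI) in Hy.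
      apply Rabs_def2 in Hy. lra. }
    generalize (filter_and _ _ Q S). apply filter_imp. intros y [Hy Hpos].
    change (Rabs (weight y - weight PI) < b * eps) in Hy.
    change (Rabs (decay b y - decay b PI) < eps).
    unfold weight at 2 in Hy. unfold decay at 2.
    destruct (Rlt_dec PI PI); [lra|]. rewrite Rminus_0_r in *.
    rewrite Rabs_pos_eq in Hy by (apply weight_nonneg; lra).
    rewrite Rabs_pos_eq by (apply decay_bounds; lra).
    unfold decay. destruct (Rlt_dec y PI) as [L|L]; [|apply cond_pos].
    assert (W := weight_pos y ltac:(lra)).
    eapply Rle_lt_trans; [apply exp_opp_le_inv, Rdiv_lt_0_compat; lra|].
    replace (/ (b / weight y)) with (weight y / b) by (field; lra).
    apply (Rmult_lt_reg_r b); [exact Hb|]. unfold Rdiv.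
    rewrite Rmult_assoc, Rinv_l by lra. lra.
Qed.

Lemma ex_RInt_decay (b : R) : 0 < b -> ex_RInt (decay b) 0 PI.
Proof.
  intros Hb. assert (HPI := PI_RGT_0).
  apply (ex_RInt_continuous (V := R_CompleteNormedModule)).
  rewrite Rmin_left, Rmax_right by lra. intros v Hv. now apply continuous_decay.
Qed.

Lemma phi_eq (b : R) : phi b = / PI * RInt (decay b) 0 PI.
Proof.
  assert (HPI := PI_RGT_0). unfold phi. f_equal. apply RInt_ext.
  rewrite Rmin_left, Rmax_right by lra. intros v Hv.
  rewrite decay_eq by lra. rewrite inv_weight by exact Hv. f_equal. unfold Rdiv. ring.
Qed.

Lemma phi_bounds (b : R) : 0 < b -> 0 <= phi b <= exp (- (b / exp 1)).
Proof.
  intros Hb. assert (HPI := PI_RGT_0). rewrite phi_eq.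
  assert (Hi := Rinv_0_lt_compat _ HPI). assert (He := ex_RInt_decay b Hb).
  split.
  - apply Rmult_le_pos; [lra|]. apply RInt_ge_0; [lra|exact He|].
    intros v Hv. apply decay_bounds; lra.
  - apply (Rmult_le_reg_l PI); [exact HPI|]. rewrite <- Rmult_assoc, Rinv_r, Rmult_1_l by lra.
    eapply Rle_trans; [apply Rle_abs|].
    replace (PI * _) with ((PI - 0) * exp (- (b / exp 1))) by ring.
    apply abs_RInt_le_const; [lra|exact He|]. intros v Hv.
    assert (D := decay_bounds b v ltac:(lra) ltac:(lra)). rewrite Rabs_pos_eq; lra.
Qed.

Lemma phi_le_1 (b : R) : 0 < b -> phi b <= 1.
Proof.
  intros Hb. eapply Rle_trans; [apply phi_bounds, Hb|].
  apply Rle_trans with (exp 0); [apply exp_monotone|rewrite exp_0; lra].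
  assert (0 < b / exp 1) by (apply Rdiv_lt_0_compat; [exact Hb|apply exp_pos]). lra.
Qed.

(** [|e^(-b x) - e^(-c x)| <= |c - b| x e^(-m x) <= |c - b| / m] when
    [m <= min b c], uniformly in [x = 1 / weight v]. *)
Lemma decay_lipschitz (m b c v : R) : 0 < m -> m <= b -> m <= c -> 0 <= v ->
  Rabs (decay c v - decay b v) <= Rabs (c - b) / m.
Proof.
  intros Hm Hb Hc Hv.
  enough (P : forall b c, m <= b <= c -> 0 <= decay b v - decay c v <= (c - b) / m).
  { destruct (Rle_dec b c) as [L|L].
    - specialize (P b c ltac:(lra)). rewrite Rabs_minus_sym.
      rewrite !Rabs_pos_eq by lra. lra.
    - specialize (P c b ltac:(lra)). rewrite (Rabs_minus_sym c b).
      rewrite !Rabs_pos_eq by lra. lra. }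
  clear b c Hb Hc. intros b c Hbc. unfold decay. destruct (Rlt_dec v PI) as [L|L].
  2:{ split; [lra|]. rewrite Rminus_0_r. apply Rdiv_le_0_compat; lra. }
  assert (W := weight_pos v ltac:(lra)). assert (I := Rinv_0_lt_compat _ W).
  unfold Rdiv. set (x := / weight v) in *.
  replace (- (c * x)) with (- (b * x) + - ((c - b) * x)) by ring. rewrite exp_plus.
  assert (E1 := exp_ineq1_le (- ((c - b) * x))).
  assert (E2 : exp (- ((c - b) * x)) <= 1).
  { rewrite <- exp_0. apply exp_monotone. nra. }
  assert (E3 : exp (- (b * x)) <= exp (- (m * x))) by (apply exp_monotone; nra).
  assert (E4 := exp_pos (- (b * x))).
  assert (E5 : x * exp (- (m * x)) <= / m).
  { assert (K := exp_opp_le_inv (m * x) ltac:(nra)). rewrite Rinv_mult in K.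
    apply (Rmult_le_compat_l x) in K; [|lra].
    replace (x * (/ m * / x)) with (/ m) in K by (field; lra). exact K. }
  split; [nra|].
  apply Rle_trans with ((c - b) * (x * exp (- (m * x)))); [nra|].
  apply Rmult_le_compat_l; lra.
Qed.

Lemma continuous_phi (b : R) : 0 < b -> continuous phi b.
Proof.
  intros Hb. assert (HPI := PI_RGT_0). apply filterlim_locally. intros eps.
  assert (P : 0 < Rmin (b / 2) (b / 2 * eps)).
  { apply Rmin_glb_lt; [lra|]. apply Rmult_lt_0_compat; [lra|apply cond_pos]. }
  exists (mkposreal _ P). intros c Hc.
  change (Rabs (c - b) < Rmin (b / 2) (b / 2 * eps)) in Hc.
  change (Rabs (phi c - phi b) < eps).
  assert (H1 := Rlt_le_trans _ _ _ Hc (Rmin_l _ _)).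
  assert (H2 := Rlt_le_trans _ _ _ Hc (Rmin_r _ _)).
  apply Rabs_def2 in H1.
  assert (Ec := ex_RInt_decay c ltac:(lra)). assert (Eb := ex_RInt_decay b Hb).
  rewrite !phi_eq, <- Rmult_minus_distr_l, Rabs_mult.
  rewrite Rabs_pos_eq by (apply Rlt_le, Rinv_0_lt_compat, HPI).
  change (/ PI * Rabs (minus (RInt (decay c) 0 PI) (RInt (decay b) 0 PI)) < eps).
  rewrite <- (RInt_minus (V := R_CompleteNormedModule)) by assumption.
  assert (K : Rabs (RInt (fun v => minus (decay c v) (decay b v)) 0 PI)
     <= (PI - 0) * (Rabs (c - b) / (b / 2))).
  { apply abs_RInt_le_const; [lra| |].
    - apply (ex_RInt_minus (V := R_NormedModule)); assumption.
    - intros v Hv. apply decay_lipschitz; lra. }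
  apply (Rmult_lt_reg_l PI); [exact HPI|]. rewrite <- Rmult_assoc, Rinv_r, Rmult_1_l by lra.
  eapply Rle_lt_trans; [exact K|]. rewrite Rminus_0_r.
  apply Rmult_lt_compat_l; [exact HPI|].
  apply (Rmult_lt_reg_r (b / 2)); [lra|]. unfold Rdiv at 1.
  rewrite Rmult_assoc, Rinv_l, Rmult_1_r by lra. lra.
Qed.

(** * The Laplace transform of the density *)

(** A quadratic remainder uniform in [v] takes the place of joint continuity of
    the derivative, which would have to be checked near [v = PI]. *)
Lemma Rderive_CInt_param (F : R -> R -> C) (d : R -> C) (x a b K e : R) :
  a <= b -> 0 < e ->
  (forall y, Rabs (y - x) < e -> ex_CInt (F y) a b) -> ex_CInt d a b ->
  (forall y v, Rabs (y - x) < e -> a <= v <= b ->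
     Cmod (F y v - F x v - RtoC (y - x) * d v) <= K * (y - x) ^ 2) ->
  Rderive (fun y => CInt (F y) a b) x (CInt d a b).
Proof.
  intros Hab He HF Hd H. apply Rderive_eps. intros eps Heps.
  set (L := (b - a) * Rabs K + 1).
  assert (HL : 0 < L).
  { assert (0 <= (b - a) * Rabs K) by (apply Rmult_le_pos; [lra|apply Rabs_pos]).
    unfold L. lra. }
  exists (Rmin e (eps / L)). split.
  { apply Rmin_glb_lt; [exact He|apply Rdiv_lt_0_compat; assumption]. }
  intros y Hy.
  assert (H1 := Rlt_le_trans _ _ _ Hy (Rmin_l _ _)).
  assert (H2 := Rlt_le_trans _ _ _ Hy (Rmin_r _ _)).
  assert (Hx : Rabs (x - x) < e) by (rewrite Rminus_diag, Rabs_R0; exact He).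
  assert (N : Cmod (CInt (F y) a b - CInt (F x) a b - RtoC (y - x) * CInt d a b)
     <= (b - a) * (Rabs K * (y - x) ^ 2)).
  { apply (is_CInt_bound (fun v => F y v - F x v - RtoC (y - x) * d v)%C); [exact Hab| |].
    - intros v Hv. eapply Rle_trans; [apply H; assumption|].
      apply Rmult_le_compat_r; [apply pow2_ge_0|apply Rle_abs].
    - apply is_CInt_minus.
      + apply is_CInt_minus; apply CInt_correct, HF; assumption.
      + apply is_CInt_mult_l, CInt_correct, Hd. }
  eapply Rle_trans; [exact N|]. rewrite <- (pow2_abs (y - x)).
  apply (Rmult_lt_compat_l L) in H2; [|exact HL].
  replace (L * (eps / L)) with eps in H2 by (field; lra).
  assert (P := Rabs_pos (y - x)). unfold L in H2. nra.
Qed.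

(** With [x = 1 / weight v] this is [e^(- b (p + x)) / (p + x)], the integral over
    [[b, +oo)] of [e^(- p xi) e^(- xi x)]. *)
Definition damped_resolvent (p : C) (b v : R) : C :=
  (RtoC (decay b v) * Cexp (- (p * RtoC b)) * resolvent p v)%C.

Lemma resolvent_eq (p : C) (v : R) : 0 <= fst p -> 0 <= v < PI ->
  (p + RtoC (/ weight v) <> 0)%C /\ resolvent p v = (/ (p + RtoC (/ weight v)))%C.
Proof.
  intros Hp Hv. assert (W := weight_pos v Hv).
  assert (D := resolvent_denom p v Hp (proj1 Hv)).
  assert (D0 : (1 + p * RtoC (weight v) <> 0)%C) by (apply Cmod_gt_0; lra).
  assert (W0 : RtoC (weight v) <> 0) by (intros E; apply RtoC_inj in E; lra).
  assert (E : (p + RtoC (/ weight v) = (1 + p * RtoC (weight v)) / RtoC (weight v))%C)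
    by (rewrite RtoC_inv by lra; field; exact W0).
  assert (N : (p + RtoC (/ weight v) <> 0)%C).
  { apply Cmod_gt_0. eapply Rlt_le_trans; [|apply fst_le_Cmod]. simpl.
    assert (0 < / weight v) by apply Rinv_0_lt_compat, W. rewrite Rabs_pos_eq; lra. }
  split; [exact N|]. rewrite E. unfold resolvent. field. split; assumption.
Qed.

Lemma decay_Cexp (p : C) (b v : R) : v < PI ->
  (RtoC (decay b v) * Cexp (- (p * RtoC b)) = Cexp (- (RtoC b * (p + RtoC (/ weight v)))))%C.
Proof.
  intros Hv. rewrite decay_eq by exact Hv.
  replace (- (RtoC b * (p + RtoC (/ weight v))))%C
    with (RtoC (- (b / weight v)) + - (p * RtoC b))%C.
  - rewrite Cexp_plus. f_equal. unfold Cexp; simpl. rewrite sin_0, cos_0.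
    apply injective_projections; simpl; ring.
  - unfold Rdiv. rewrite RtoC_opp, RtoC_mult. ring.
Qed.

Lemma resolvent_PI (p : C) : resolvent p PI = 0.
Proof.
  unfold resolvent, weight. destruct (Rlt_dec PI PI); [lra|]. unfold Cdiv. apply Cmult_0_l.
Qed.

Lemma decay_PI (b : R) : decay b PI = 0.
Proof. unfold decay. destruct (Rlt_dec PI PI); lra. Qed.

Lemma ex_CInt_damped (p : C) (b : R) : 0 <= fst p -> 0 < b ->
  ex_CInt (damped_resolvent p b) 0 PI.
Proof.
  intros Hp Hb. assert (HPI := PI_RGT_0). apply ex_CInt_continuous; [lra|]. intros v Hv.
  unfold damped_resolvent. apply continuous_Cmult; [|apply continuous_resolvent; assumption].
  apply continuous_Cmult; [|apply continuous_const].
  apply continuous_RtoC, continuous_decay; assumption.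
Qed.

(** With [q = p + x] the second-order remainder carries a factor [|q|], unbounded
    as [v] approaches [PI]; half of the exponential decay absorbs it, since
    [x e^(- b x / 2) <= 2 / b]. *)
Lemma damped_resolvent_taylor (p : C) (b c v : R) :
  0 <= fst p -> 0 < b -> Rabs (c - b) < b / 2 -> 0 <= v <= PI ->
  Cmod (damped_resolvent p c v - damped_resolvent p b v
        - RtoC (c - b) * (- (RtoC (decay b v) * Cexp (- (p * RtoC b)))))
    <= (Cmod p + 2 / b) * (c - b) ^ 2.
Proof.
  intros Hp Hb Hc Hv. assert (P0 := Cmod_ge_0 p).
  assert (Q0 : 0 < 2 / b) by (apply Rdiv_lt_0_compat; lra).
  unfold damped_resolvent.
  destruct (Req_dec_T v PI) as [->|Hne].
  { rewrite resolvent_PI, !decay_PI.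
    replace (_ - _ - _)%C with (RtoC 0) by ring. rewrite Cmod_0.
    apply Rmult_le_pos; [lra|apply pow2_ge_0]. }
  assert (Hv' : 0 <= v < PI) by lra.
  destruct (resolvent_eq p v Hp Hv') as [Hq0 ->].
  rewrite !decay_Cexp by lra.
  assert (W := weight_pos v Hv'). assert (X := Rinv_0_lt_compat _ W).
  set (x := / weight v) in *. set (q := (p + RtoC x)%C) in *.
  set (s := (- (RtoC (c - b) * q))%C).
  assert (Ec : Cexp (- (RtoC c * q)) = (Cexp (- (RtoC b * q)) * Cexp s)%C).
  { rewrite <- Cexp_plus. f_equal. unfold s. rewrite RtoC_minus. ring. }
  rewrite Ec.
  replace (Cexp (- (RtoC b * q)) * Cexp s * / q - Cexp (- (RtoC b * q)) * / q
      - RtoC (c - b) * - Cexp (- (RtoC b * q)))%C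
    with (Cexp (- (RtoC b * q)) * (Cexp s - 1 - s) / q)%C
    by (unfold s; field; exact Hq0).
  assert (Hq : 0 < Cmod q) by (apply Cmod_gt_0, Hq0).
  assert (Req : fst q = fst p + x) by reflexivity.
  rewrite Cmod_div, Cmod_mult, Cmod_Cexp by exact Hq0.
  assert (T := Cexp_taylor2 s).
  assert (Hs : Cmod s = Rabs (c - b) * Cmod q)
    by (unfold s; rewrite Cmod_opp, Cmod_mult, Cmod_R; reflexivity).
  assert (Hm : Rmax 0 (fst s) <= b / 2 * fst q).
  { apply Rmax_lub; [nra|].
    replace (fst s) with (- (c - b) * fst q) by (unfold s; simpl; ring).
    apply Rmult_le_compat_r; [lra|]. apply Rabs_def2 in Hc. lra. }
  assert (Hf : fst (- (RtoC b * q))%C = - (b * fst q)) by (simpl; ring).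
  rewrite Hf.
  assert (M1 : exp (- (b * fst q)) * exp (Rmax 0 (fst s)) <= exp (- (b / 2 * x))).
  { rewrite <- exp_plus. apply exp_monotone. rewrite Req in *. nra. }
  assert (M2 : x * exp (- (b / 2 * x)) <= 2 / b).
  { assert (K := exp_opp_le_inv (b / 2 * x) ltac:(nra)).
    apply (Rmult_le_compat_l x) in K; [|lra].
    replace (x * / (b / 2 * x)) with (2 / b) in K by (field; lra). exact K. }
  assert (M3 : exp (- (b / 2 * x)) <= 1) by (rewrite <- exp_0; apply exp_monotone; nra).
  assert (M4 : Cmod q <= Cmod p + x).
  { unfold q. eapply Rle_trans; [apply Cmod_triangle|]. rewrite Cmod_R, Rabs_pos_eq; lra. }
  assert (E0 := exp_pos (- (b * fst q))). assert (E1 := exp_pos (- (b / 2 * x))).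
  set (Y := exp (- (b / 2 * x))) in *.
  apply Rle_trans with ((c - b) ^ 2 * (Cmod q * Y)).
  - apply (Rmult_le_reg_r (Cmod q)); [exact Hq|]. unfold Rdiv.
    rewrite Rmult_assoc, Rinv_l, Rmult_1_r by lra.
    apply Rle_trans with (exp (- (b * fst q)) * (Cmod s ^ 2 * exp (Rmax 0 (fst s)))).
    { apply Rmult_le_compat_l; [lra|exact T]. }
    rewrite Hs, Rpow_mult_distr, pow2_abs.
    replace (exp (- (b * fst q)) * ((c - b) ^ 2 * Cmod q ^ 2 * exp (Rmax 0 (fst s))))
      with ((c - b) ^ 2 * Cmod q ^ 2 * (exp (- (b * fst q)) * exp (Rmax 0 (fst s)))) by ring.
    replace ((c - b) ^ 2 * (Cmod q * Y) * Cmod q) with ((c - b) ^ 2 * Cmod q ^ 2 * Y) by ring.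
    apply Rmult_le_compat_l; [|exact M1]. apply Rmult_le_pos; apply pow2_ge_0.
  - rewrite Rmult_comm. apply Rmult_le_compat_r; [apply pow2_ge_0|].
    apply Rle_trans with ((Cmod p + x) * Y); [|nra].
    apply Rmult_le_compat_r; lra.
Qed.

Lemma is_CInt_RtoC (f : R -> R) (a b l : R) :
  is_RInt f a b l -> is_CInt (fun t => RtoC (f t)) a b (RtoC l).
Proof.
  intros H. apply (is_RInt_fct_extend_pair (fun t => RtoC (f t))); [exact H|].
  assert (K := is_RInt_const (V := R_NormedModule) a b 0).
  rewrite (scal_zero_r (V := R_NormedModule)) in K. exact K.
Qed.

Lemma continuous_Cexp_lin (p : C) (b : R) : continuous (fun b => Cexp (- (p * RtoC b)))%C b.
Proof.
  apply (continuous_comp (fun b => - (p * RtoC b))%C Cexp).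
  - apply (continuous_opp (V := C_R_NormedModule)).
    apply continuous_Cmult; [apply continuous_const|].
    apply continuous_RtoC, continuous_id.
  - eapply Cderive_continuous, Cderive_Cexp.
Qed.

(** Fubini's theorem for the double integral of [e^(- (p + x) xi)], obtained by
    differentiating the right-hand side with respect to the end point. *)
Lemma laplace_phi_segment (p : C) (al be : R) : 0 <= fst p -> 0 < al <= be ->
  is_CInt (fun xi => Cexp (- (p * RtoC xi)) * RtoC (phi xi))%C al be
    ((CInt (damped_resolvent p al) 0 PI - CInt (damped_resolvent p be) 0 PI) / RtoC PI)%C.
Proof.
  intros Hp Hab. assert (HPI := PI_RGT_0).
  assert (HPI0 : RtoC PI <> 0) by (intros E; apply RtoC_inj in E; lra).
  replace ((CInt (damped_resolvent p al) 0 PI - CInt (damped_resolvent p be) 0 PI) / RtoC PI)%C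
    with (- / RtoC PI * CInt (damped_resolvent p be) 0 PI
          - - / RtoC PI * CInt (damped_resolvent p al) 0 PI)%C by (field; exact HPI0).
  apply (CInt_ftc (fun b => - / RtoC PI * CInt (damped_resolvent p b) 0 PI)%C); [lra| |].
  - intros b Hb.
    assert (E : is_CInt (fun v => - Cexp (- (p * RtoC b)) * RtoC (decay b v))%C 0 PI
       (- Cexp (- (p * RtoC b)) * RtoC (PI * phi b))%C).
    { apply is_CInt_mult_l, is_CInt_RtoC.
      assert (Ephi : PI * phi b = RInt (decay b) 0 PI) by (rewrite phi_eq; field; lra).
      rewrite Ephi. apply (RInt_correct (V := R_CompleteNormedModule)), ex_RInt_decay. lra. }
    assert (D : Rderive (fun b => CInt (damped_resolvent p b) 0 PI) b
       (CInt (fun v => - Cexp (- (p * RtoC b)) * RtoC (decay b v))%C 0 PI)).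
    { apply (Rderive_CInt_param _ _ b 0 PI (Cmod p + 2 / b) (b / 2)); try lra.
      - intros c Hc. apply Rabs_def2 in Hc. apply ex_CInt_damped; [exact Hp|lra].
      - eexists. exact E.
      - intros c v Hc Hv.
        replace (- Cexp (- (p * RtoC b)) * RtoC (decay b v))%C
          with (- (RtoC (decay b v) * Cexp (- (p * RtoC b))))%C by ring.
        apply damped_resolvent_taylor; try assumption. lra. }
    rewrite (is_CInt_unique _ _ _ _ E) in D.
    replace (Cexp (- (p * RtoC b)) * RtoC (phi b))%C
      with (- / RtoC PI * (- Cexp (- (p * RtoC b)) * RtoC (PI * phi b)))%C
      by (rewrite RtoC_mult; field; exact HPI0).
    apply (Rderive_comp (fun u => - / RtoC PI * u)%C
      (fun b => CInt (damped_resolvent p b) 0 PI)); [|exact D].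
    eapply Cderive_eq; [apply Cderive_mult; [apply Cderive_const|apply Cderive_id]|].
    cbv beta. ring.
  - intros b Hb. apply continuous_Cmult; [apply continuous_Cexp_lin|].
    apply continuous_RtoC, continuous_phi. lra.
Qed.

(** * The principal branch over the closed right half-plane *)

Lemma slit_plane_right (z : C) : 0 <= fst z -> slit_plane z.
Proof.
  intros Hz [_ H]. assert (K := Rinv_0_lt_compat _ (exp_pos 1)). unfold Rdiv in H. lra.
Qed.

(** On the path [s^2 z], [W] starts at [0] and cannot reach the lines
    [Im w = PI/2] and [Im w = - PI/2], where [Re (w e^w) < 0]. *)
Lemma principal_right_branch (W : C -> C) (z : C) :
  is_principal_LambertW W -> 0 <= fst z -> z <> 0 -> right_branch (W z).
Proof.
  intros [Hhol [Heq H0]] Hz Hz0. assert (HPI := PI_RGT_0).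
  set (path := fun s => (RtoC (s * s) * z)%C).
  assert (Hpath : forall s, 0 <= fst (path s)).
  { intros s. unfold path. simpl. assert (0 <= s * s) by nra. nra. }
  set (y := fun s => snd (W (path s))).
  assert (Hy : continuity y).
  { intros s. apply continuity_pt_filterlim. unfold y.
    change (continuous (fun s => snd (W (path s))) s). apply continuous_im.
    apply (continuous_comp path W).
    - apply continuous_Cmult; [|apply continuous_const].
      apply continuous_RtoC, continuous_Rmult; apply continuous_id.
    - destruct (Hhol (path s) (slit_plane_right _ (Hpath s))) as [l Hl].
      exact (Cderive_continuous _ _ _ Hl). }
  assert (Hno : forall s, Rabs (y s) <> PI / 2).
  { intros s E. assert (K := Heq (path s) (slit_plane_right _ (Hpath s))).
    specialize (Hpath s). rewrite <- K in Hpath. unfold y in E.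
    destruct (W (path s)) as [p q]. unfold Cexp in Hpath. simpl in E, Hpath.
    assert (Hp := exp_pos p).
    assert (J : q = PI / 2 \/ q = - (PI / 2)).
    { unfold Rabs in E. destruct (Rcase_abs q); [right|left]; lra. }
    destruct J; subst q; rewrite ?cos_neg, ?sin_neg, cos_PI2, sin_PI2 in Hpath; nra. }
  assert (Hy0 : y 0 = 0).
  { unfold y, path. rewrite Rmult_0_l, Cmult_0_l, H0. reflexivity. }
  assert (Hp1 : path 1 = z).
  { unfold path. rewrite Rmult_1_l. apply Cmult_1_l. }
  assert (Hlt : Rabs (y 1) < PI / 2).
  { apply Rnot_le_lt. intros L.
    destruct (IVT_gen (fun s => Rabs (y s)) 0 1 (PI / 2)) as [s [_ Hs]].
    - intros s. apply (continuity_pt_comp y Rabs); [apply Hy|apply Rcontinuity_abs].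
    - rewrite Hy0, Rabs_R0, Rmin_left, Rmax_right by lra. lra.
    - exact (Hno s Hs). }
  assert (Hz1 := Heq z (slit_plane_right z Hz)).
  unfold y in Hlt. rewrite Hp1 in Hlt. unfold right_branch. rewrite Hz1.
  split; [|split; assumption].
  rewrite <- Hz1 in Hz, Hz0. destruct (W z) as [p q]. unfold Cexp in Hz; simpl in *.
  assert (Ep := exp_pos p). apply Rabs_def2 in Hlt.
  assert (Hc : 0 < cos q) by (apply cos_gt_0; lra).
  assert (Re : 0 <= p * cos q - q * sin q) by nra.
  assert (Hs : q <> 0 -> 0 < q * sin q).
  { intros Hq. destruct (Rtotal_order q 0) as [L|[L|L]]; [|contradiction|].
    - assert (sin q < 0) by (apply sin_lt_0_var; lra). nra.
    - assert (0 < sin q) by (apply sin_gt_0; lra). nra. }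
  destruct (Req_dec_T q 0) as [Hq|Hq].
  - subst q. rewrite cos_0 in Re. destruct (Req_dec_T p 0) as [Hp|Hp]; [|lra].
    subst p. exfalso. apply Hz0. apply Cmult_0_l.
  - specialize (Hs Hq). nra.
Qed.

(** Differentiating [W e^W = t z] along the ray gives [(1 + W) e^W W' = z], and
    [resolvent_integral] evaluates the factor [(1 + W) e^W]. *)
Lemma principal_ray_derive (W : C -> C) (z : C) (t : R) :
  is_principal_LambertW W -> 0 <= fst z -> 0 < t ->
  Rderive (fun s => W (RtoC s * z)%C) t
    (z / RtoC PI * CInt (resolvent (RtoC t * z)) 0 PI)%C.
Proof.
  intros HW Hz Ht. assert (HPI := PI_RGT_0).
  assert (HPI0 : RtoC PI <> 0) by (intros E; apply RtoC_inj in E; lra).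
  destruct (Ceq_dec z 0) as [->|Hz0].
  { rewrite Cmult_0_r. replace (0 / RtoC PI * _)%C with (RtoC 0) by (field; exact HPI0).
    apply (is_derive_ext (K := R_AbsRing) (V := C_R_NormedModule) (fun _ => W 0)).
    - intros s. now rewrite Cmult_0_r.
    - apply (is_derive_const (V := C_R_NormedModule)). }
  set (p := (RtoC t * z)%C).
  assert (Hp : 0 <= fst p) by (unfold p; simpl; nra).
  assert (Hp0 : p <> 0).
  { apply Cmult_neq_0; [|exact Hz0]. intros E. apply RtoC_inj in E. lra. }
  assert (B := principal_right_branch W p HW Hp Hp0).
  destruct HW as [Hhol [Heq _]].
  assert (Ep := Heq p (slit_plane_right p Hp)).
  assert (I := resolvent_integral (W p) B). rewrite Ep in I.
  destruct (Hhol p (slit_plane_right p Hp)) as [L HL].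
  assert (Hray : Rderive (fun s => RtoC s * z)%C t z).
  { destruct z as [a b]. apply Rderive_pair; simpl; auto_derive; trivial; ring. }
  assert (D := Rderive_comp W (fun s => RtoC s * z)%C t L z HL Hray).
  set (w := W p) in *. set (J := CInt (resolvent p) 0 PI) in *.
  assert (D2 : Rderive (fun s => W (RtoC s * z) * Cexp (W (RtoC s * z)))%C t
      ((1 + w) * Cexp w * (L * z))%C).
  { apply (Rderive_comp (fun u => u * Cexp u)%C (fun s => W (RtoC s * z))%C); [|exact D].
    fold p. fold w. eapply Cderive_eq.
    - apply Cderive_mult; [apply Cderive_id|apply Cderive_Cexp].
    - cbv beta. ring. }
  assert (D3 : Rderive (fun s => W (RtoC s * z) * Cexp (W (RtoC s * z)))%C t z).
  { apply (is_derive_ext_loc (K := R_AbsRing) (V := C_R_NormedModule)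
      (fun s => RtoC s * z)%C); [|exact Hray].
    exists (mkposreal _ Ht). intros s Hs. change (Rabs (s - t) < t) in Hs.
    apply Rabs_def2 in Hs. symmetry. apply Heq, slit_plane_right. simpl. nra. }
  assert (E : ((1 + w) * Cexp w * (L * z) = z)%C).
  { apply Rderive_fst_snd in D2. apply Rderive_fst_snd in D3.
    destruct D2 as [D21 D22]. destruct D3 as [D31 D32].
    apply is_derive_unique in D21. apply is_derive_unique in D22.
    apply is_derive_unique in D31. apply is_derive_unique in D32.
    apply injective_projections; congruence. }
  replace (z / RtoC PI * J)%C with (L * z)%C; [exact D|].
  rewrite <- E at 2.
  transitivity (L * z * ((1 + w) * Cexp w * J) / RtoC PI)%C; [rewrite I|]; field;
    exact HPI0.
Qed.

(** * The truncated integral *)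

Definition integrand (z : C) (xi : R) : C :=
  ((RtoC 1 - Cexp (- (z * RtoC xi))) / RtoC xi * RtoC (phi xi))%C.

Lemma RtoC_neq_0 (x : R) : x <> 0 -> RtoC x <> 0.
Proof. intros H E. apply RtoC_inj in E. contradiction. Qed.

Lemma continuous_integrand (z : C) (xi : R) : 0 < xi -> continuous (integrand z) xi.
Proof.
  intros H. unfold integrand. apply continuous_Cmult; [|apply continuous_RtoC, continuous_phi, H].
  apply continuous_Cmult.
  - apply continuous_Cminus; [apply continuous_const|apply continuous_Cexp_lin].
  - apply (continuous_comp RtoC Cinv).
    + apply continuous_RtoC, continuous_id.
    + eapply Cderive_continuous, Cderive_inv, RtoC_neq_0. lra.
Qed.

Lemma ex_CInt_integrand (z : C) (al be : R) : 0 < al <= be -> ex_CInt (integrand z) al be.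
Proof.
  intros H. apply ex_CInt_continuous; [lra|]. intros t Ht. apply continuous_integrand. lra.
Qed.

Lemma integrand_bound (z : C) (xi : R) : 0 <= fst z -> 0 < xi ->
  Cmod (integrand z xi) <= Cmod z * exp (- (xi / exp 1)).
Proof.
  intros Hz Hx. unfold integrand.
  assert (P := phi_bounds xi Hx).
  rewrite Cmod_mult, Cmod_div, !Cmod_R, (Rabs_pos_eq xi), (Rabs_pos_eq (phi xi))
    by (try apply RtoC_neq_0; lra).
  apply Rmult_le_compat; try lra.
  - apply Rdiv_le_0_compat; [apply Cmod_ge_0|exact Hx].
  - apply (Rmult_le_reg_r xi); [exact Hx|]. unfold Rdiv.
    rewrite Rmult_assoc, Rinv_l, Rmult_1_r by lra.
    replace (RtoC 1 - Cexp (- (z * RtoC xi)))%C with (- (Cexp (- (z * RtoC xi)) - 1))%C by ring.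
    rewrite Cmod_opp. eapply Rle_trans; [apply Cexp_taylor1|].
    rewrite Rmax_left by (simpl; nra).
    rewrite exp_0, Cmod_opp, Cmod_mult, Cmod_R, Rabs_pos_eq by lra. lra.
Qed.

Lemma truncated_ray_derive (z : C) (al be t : R) : 0 <= fst z -> 0 < al <= be -> 0 <= t ->
  Rderive (fun s => CInt (integrand (RtoC s * z)) al be) t
    (z * CInt (fun xi => Cexp (- (RtoC t * z * RtoC xi)) * RtoC (phi xi))%C al be)%C.
Proof.
  intros Hz Hab Ht.
  assert (Htz : 0 <= fst (RtoC t * z)%C) by (simpl; nra).
  assert (I := laplace_phi_segment (RtoC t * z) al be Htz Hab).
  assert (I2 := is_CInt_mult_l z _ _ _ _ I).
  rewrite (is_CInt_unique _ _ _ _ I), <- (is_CInt_unique _ _ _ _ I2).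
  apply (Rderive_CInt_param _ _ t al be (Cmod z ^ 2 * be * exp (Cmod z * be)) 1); try lra.
  - intros s _. apply ex_CInt_integrand, Hab.
  - eexists. exact I2.
  - intros s xi Hs Hxi. unfold integrand.
    assert (Hxi0 : RtoC xi <> 0) by (apply RtoC_neq_0; lra).
    set (e := Cexp (- (RtoC t * z * RtoC xi))).
    set (sg := (- (RtoC (s - t) * z * RtoC xi))%C).
    replace (Cexp (- (RtoC s * z * RtoC xi))) with (e * Cexp sg)%C
      by (unfold e, sg; rewrite <- Cexp_plus, RtoC_minus; f_equal; ring).
    replace ((RtoC 1 - e * Cexp sg) / RtoC xi * RtoC (phi xi)
        - (RtoC 1 - e) / RtoC xi * RtoC (phi xi)
        - RtoC (s - t) * (z * (e * RtoC (phi xi))))%C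
      with (- (e * (Cexp sg - 1 - sg) / RtoC xi * RtoC (phi xi)))%C
      by (unfold sg; field; exact Hxi0).
    assert (P := phi_bounds xi ltac:(lra)). assert (P1 := phi_le_1 xi ltac:(lra)).
    rewrite Cmod_opp, Cmod_mult, Cmod_div, Cmod_mult, !Cmod_R by exact Hxi0.
    rewrite (Rabs_pos_eq xi), (Rabs_pos_eq (phi xi)) by lra.
    assert (E : Cmod e <= 1).
    { unfold e. rewrite Cmod_Cexp, <- exp_0. apply exp_monotone. simpl in *. nra. }
    assert (Hz0 := Cmod_ge_0 z).
    assert (Hsg : Cmod sg = Rabs (s - t) * Cmod z * xi).
    { unfold sg. rewrite Cmod_opp, !Cmod_mult, !Cmod_R, (Rabs_pos_eq xi) by lra. reflexivity. }
    assert (A0 := Rabs_pos (s - t)).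
    assert (T : Cmod (Cexp sg - 1 - sg)
       <= Cmod z ^ 2 * be * exp (Cmod z * be) * (s - t) ^ 2 * xi).
    { eapply Rle_trans; [apply Cexp_taylor2|].
      assert (Q : exp (Rmax 0 (fst sg)) <= exp (Cmod z * be)).
      { apply exp_monotone, Rmax_lub; [nra|].
        eapply Rle_trans; [apply Rle_abs|]. eapply Rle_trans; [apply fst_le_Cmod|].
        rewrite Hsg, Rmult_assoc, <- (Rmult_1_l (Cmod z * be)).
        apply Rmult_le_compat; [exact A0|nra|lra|apply Rmult_le_compat_l; lra]. }
      rewrite Hsg, !Rpow_mult_distr, pow2_abs.
      replace (Cmod z ^ 2 * be * exp (Cmod z * be) * (s - t) ^ 2 * xi)
        with ((s - t) ^ 2 * Cmod z ^ 2 * (xi * be) * exp (Cmod z * be)) by ring.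
      assert (Q0 := exp_pos (Rmax 0 (fst sg))).
      assert (Z : 0 <= (s - t) ^ 2 * Cmod z ^ 2) by (apply Rmult_le_pos; apply pow2_ge_0).
      apply Rmult_le_compat; [|lra| |exact Q].
      - apply Rmult_le_pos; [exact Z|apply pow2_ge_0].
      - apply Rmult_le_compat_l; [exact Z|nra]. }
    assert (T0 := Cmod_ge_0 (Cexp sg - 1 - sg)). assert (E0 := Cmod_ge_0 e).
    set (G := Cmod z ^ 2 * be * exp (Cmod z * be) * (s - t) ^ 2) in *.
    assert (Q : Cmod e * Cmod (Cexp sg - 1 - sg) / xi <= G).
    { apply (Rmult_le_reg_r xi); [lra|]. unfold Rdiv.
      rewrite Rmult_assoc, Rinv_l, Rmult_1_r by lra. nra. }
    assert (Q1 : 0 <= Cmod e * Cmod (Cexp sg - 1 - sg) / xi).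
    { apply Rdiv_le_0_compat; [nra|lra]. }
    nra.
Qed.

Lemma damped_resolvent_bound (p : C) (b v : R) : 0 <= fst p -> 0 < b -> 0 <= v ->
  Cmod (damped_resolvent p b v) <= exp 1 * exp (- (b / exp 1)).
Proof.
  intros Hp Hb Hv. unfold damped_resolvent. rewrite !Cmod_mult, Cmod_R, Cmod_Cexp.
  assert (D := decay_bounds b v ltac:(lra) Hv). rewrite Rabs_pos_eq by lra.
  assert (E : exp (fst (- (p * RtoC b))%C) <= 1).
  { rewrite <- exp_0. apply exp_monotone. simpl. nra. }
  assert (E0 := exp_pos (fst (- (p * RtoC b))%C)).
  assert (R1 := resolvent_bound p v Hp Hv). assert (R0 := Cmod_ge_0 (resolvent p v)).
  rewrite Rmult_comm. apply Rmult_le_compat; try lra; nra.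
Qed.

Lemma damped_resolvent_near (p : C) (b v : R) : 0 <= fst p -> 0 < b -> 0 <= v <= PI ->
  Cmod (damped_resolvent p b v - resolvent p v) <= b.
Proof.
  intros Hp Hb Hv. unfold damped_resolvent.
  destruct (Req_dec_T v PI) as [->|Hne].
  { rewrite resolvent_PI. replace (_ - _)%C with (RtoC 0) by ring. rewrite Cmod_0. lra. }
  destruct (resolvent_eq p v Hp ltac:(lra)) as [Hq ->]. rewrite decay_Cexp by lra.
  assert (X := Rinv_0_lt_compat _ (weight_pos v ltac:(lra))).
  set (q := (p + RtoC (/ weight v))%C) in *.
  assert (Hq1 : 0 < Cmod q) by (apply Cmod_gt_0, Hq).
  replace (Cexp (- (RtoC b * q)) * / q - / q)%C
    with ((Cexp (- (RtoC b * q)) - 1) / q)%C by (field; exact Hq).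
  rewrite Cmod_div by exact Hq. apply (Rmult_le_reg_r (Cmod q)); [exact Hq1|].
  unfold Rdiv. rewrite Rmult_assoc, Rinv_l, Rmult_1_r by lra.
  eapply Rle_trans; [apply Cexp_taylor1|].
  rewrite Rmax_left by (unfold q; simpl; nra).
  rewrite exp_0, Cmod_opp, Cmod_mult, Cmod_R, Rabs_pos_eq by lra. lra.
Qed.

(** Both sides vanish at [t = 0] on the ray [t z], and their derivatives differ
    only by the two ends cut off from the Laplace integral. *)
Lemma truncated_error (W : C -> C) (z : C) (al be : R) :
  is_principal_LambertW W -> 0 <= fst z -> 0 < al <= be ->
  Cmod (CInt (integrand z) al be - W z)
    <= Cmod z * (al + exp 1 * exp (- (be / exp 1))).
Proof.
  intros HW Hz Hab. assert (HPI := PI_RGT_0).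
  assert (HPI0 := RtoC_neq_0 PI (Rgt_not_eq _ _ HPI)).
  set (Delta := fun t => (CInt (integrand (RtoC t * z)) al be - W (RtoC t * z))%C).
  assert (Htz : forall t, 0 <= t -> 0 <= fst (RtoC t * z)%C) by (intros t Ht; simpl; nra).
  assert (E0 : Delta 0 = 0).
  { unfold Delta. rewrite Cmult_0_l. destruct HW as [_ [_ ->]].
    rewrite (is_CInt_unique (integrand 0) al be 0); [ring|].
    assert (I0 := is_CInt_const al be 0). rewrite Cmult_0_r in I0.
    refine (is_RInt_ext (V := C_R_NormedModule) _ _ _ _ _ _ I0).
    rewrite Rmin_left, Rmax_right by lra. intros xi Hxi. unfold integrand.
    replace (- (0 * RtoC xi))%C with (RtoC 0) by ring. rewrite Cexp_0.
    symmetry. unfold Cdiv, Cminus. rewrite Cplus_opp_r, !Cmult_0_l. reflexivity. }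
  assert (E1 : (CInt (integrand z) al be - W z)%C = (Delta 1 - Delta 0)%C).
  { rewrite E0. unfold Delta. rewrite Cmult_1_l. ring. }
  rewrite E1.
  replace (Cmod z * (al + exp 1 * exp (- (be / exp 1))))
    with (Cmod z * (al + exp 1 * exp (- (be / exp 1))) * (1 - 0)) by ring.
  apply (mean_value_ineq Delta (fun t =>
    (z * CInt (fun xi => Cexp (- (RtoC t * z * RtoC xi)) * RtoC (phi xi))%C al be
     - z / RtoC PI * CInt (resolvent (RtoC t * z)) 0 PI)%C)); [lra| | |].
  - intros t Ht. apply (is_derive_minus (V := C_R_NormedModule)).
    + apply truncated_ray_derive; try assumption. lra.
    + apply principal_ray_derive; try assumption. lra.
  - intros t Ht. apply continuous_Cminus.
    + eapply Rderive_continuous, truncated_ray_derive; try assumption. lra.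
    + apply (continuous_comp (fun t => RtoC t * z)%C W).
      * apply continuous_Cmult; [apply continuous_RtoC, continuous_id|apply continuous_const].
      * destruct HW as [Hhol _].
        destruct (Hhol _ (slit_plane_right _ (Htz t (proj1 Ht)))) as [l Hl].
        exact (Cderive_continuous _ _ _ Hl).
  - intros t Ht. set (p := (RtoC t * z)%C).
    assert (Hp : 0 <= fst p) by (apply Htz; lra).
    rewrite (is_CInt_unique _ _ _ _ (laplace_phi_segment p al be Hp Hab)).
    assert (Ir : ex_CInt (resolvent p) 0 PI).
    { apply ex_CInt_continuous; [lra|]. intros v Hv. apply continuous_resolvent; assumption. }
    set (Ia := CInt (damped_resolvent p al) 0 PI). set (Ib := CInt (damped_resolvent p be) 0 PI).
    set (I := CInt (resolvent p) 0 PI).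
    replace (z * ((Ia - Ib) / RtoC PI) - z / RtoC PI * I)%C
      with (z * ((Ia - I) - Ib) / RtoC PI)%C by (field; exact HPI0).
    rewrite Cmod_div, Cmod_mult, Cmod_R, Rabs_pos_eq by (trivial; lra).
    unfold Rdiv at 1. rewrite Rmult_assoc. apply Rmult_le_compat_l; [apply Cmod_ge_0|].
    apply (Rmult_le_reg_r PI); [exact HPI|]. rewrite Rmult_assoc, Rinv_l, Rmult_1_r by lra.
    eapply Rle_trans; [apply (Cmod_triangle (Ia - I) (- Ib))|]. rewrite Cmod_opp.
    assert (Na : Cmod (Ia - I) <= (PI - 0) * al).
    { apply (is_CInt_bound (fun v => damped_resolvent p al v - resolvent p v)%C); [lra| |].
      - intros v Hv. apply damped_resolvent_near; try assumption. lra.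
      - apply is_CInt_minus; apply CInt_correct; [apply ex_CInt_damped|]; trivial. lra. }
    assert (Nb : Cmod Ib <= (PI - 0) * (exp 1 * exp (- (be / exp 1)))).
    { apply CInt_bound; [lra|apply ex_CInt_damped; [exact Hp|lra]|].
      intros v Hv. apply damped_resolvent_bound; [exact Hp|lra|lra]. }
    lra.
Qed.

(** * Improper integrals *)

Lemma ex_RInt_gen_nonneg (f : R -> R) (B : R) :
  (forall x, 0 < x -> continuous f x) -> (forall x, 0 < x -> 0 <= f x) ->
  (forall a b, 0 < a <= b -> RInt f a b <= B) ->
  ex_RInt_gen f (at_right 0) (Rbar_locally p_infty).
Proof.
  intros Hc Hf HB.
  assert (Hex : forall a b, 0 < a <= b -> ex_RInt f a b).
  { intros a b Hab. apply (ex_RInt_continuous (V := R_CompleteNormedModule)).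
    rewrite Rmin_left, Rmax_right by lra. intros x Hx. apply Hc. lra. }
  assert (Hpos : forall a b, 0 < a <= b -> 0 <= RInt f a b).
  { intros a b Hab. apply RInt_ge_0; [lra|apply Hex, Hab|]. intros x Hx. apply Hf. lra. }
  destruct (completeness (fun y => exists a b, 0 < a <= b /\ y = RInt f a b)) as [L [HL1 HL2]].
  - exists B. intros y [a [b [Hab ->]]]. apply HB, Hab.
  - exists (RInt f 1 1), 1, 1. split; [lra|reflexivity].
  - exists L. intros P [eps HP].
    assert (Hlt : exists a b, 0 < a <= b /\ L - eps < RInt f a b).
    { apply Classical_Prop.NNPP. intros N.
      assert (K : L <= L - eps); [|assert (Q := cond_pos eps); lra].
      apply HL2. intros y [a [b [Hab ->]]]. apply Rnot_lt_le. intros M.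
      apply N. now exists a, b. }
    destruct Hlt as [a [b [Hab Hlt]]].
    apply (Filter_prod _ _ _ (fun x => 0 < x < a) (fun y => b < y)).
    + exists (mkposreal a (proj1 Hab)). intros x Hx Hx0.
      change (Rabs (x - 0) < a) in Hx. rewrite Rminus_0_r in Hx.
      apply Rabs_def2 in Hx. lra.
    + exists b. trivial.
    + intros x y Hx Hy. simpl. exists (RInt f x y). split.
      * apply (RInt_correct (V := R_CompleteNormedModule)), Hex. lra.
      * apply HP. change (Rabs (RInt f x y - L) < eps).
        assert (U : RInt f x y <= L) by (apply HL1; exists x, y; split; [lra|reflexivity]).
        assert (S1 := RInt_Chasles (V := R_CompleteNormedModule) f x a y
          ltac:(apply Hex; lra) ltac:(apply Hex; lra)).
        assert (S2 := RInt_Chasles (V := R_CompleteNormedModule) f a b y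
          ltac:(apply Hex; lra) ltac:(apply Hex; lra)).
        change (RInt f x a + RInt f a y = RInt f x y) in S1.
        change (RInt f a b + RInt f b y = RInt f a y) in S2.
        assert (P1 := Hpos x a ltac:(lra)). assert (P2 := Hpos b y ltac:(lra)).
        apply Rabs_def1; [assert (Q := cond_pos eps); lra|lra].
Qed.

Lemma RInt_exp_le (c a b : R) : 0 < c -> 0 < a <= b ->
  ex_RInt (fun x => exp (- (x / c))) a b /\ RInt (fun x => exp (- (x / c))) a b <= c.
Proof.
  intros Hc Hab.
  assert (I : is_RInt (fun x => exp (- (x / c))) a b
     (minus (- c * exp (- (b / c))) (- c * exp (- (a / c))))).
  { apply (is_RInt_derive (V := R_CompleteNormedModule) (fun x => - c * exp (- (x / c)))).
    - intros x _. auto_derive; [exact I|]. unfold Rdiv. field. lra.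
    - intros x _. apply (ex_derive_continuous (K := R_AbsRing) (V := R_NormedModule)).
      auto_derive. exact I. }
  split; [eexists; exact I|].
  rewrite (is_RInt_unique (V := R_CompleteNormedModule) _ _ _ _ I).
  change (- c * exp (- (b / c)) - - c * exp (- (a / c)) <= c).
  assert (E : exp (- (a / c)) <= 1).
  { rewrite <- exp_0. apply exp_monotone. assert (0 < a / c) by (apply Rdiv_lt_0_compat; lra). lra. }
  assert (E2 := exp_pos (- (b / c))). nra.
Qed.

Theorem theorem6p5 (W : C -> C) (hW : is_principal_LambertW W)
    (z : C) (hz : 0 <= fst z) :
  is_Cintegral_0_infty
    (fun xi : R =>
       Cmult
         (Cdiv (Cminus (RtoC 1) (Cexp (Copp (Cmult z (RtoC xi))))) (RtoC xi))
         (RtoC (phi xi)))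
    (W z).
Proof.
  change (is_Cintegral_0_infty (integrand z) (W z)).
  assert (Hz0 := Cmod_ge_0 z). assert (He := exp_pos 1).
  split.
  - apply (ex_RInt_gen_nonneg _ (Cmod z * exp 1)).
    + intros x Hx. apply (continuous_comp (integrand z) Cmod).
      * apply continuous_integrand, Hx.
      * apply continuous_Cmod.
    + intros x _. apply Cmod_ge_0.
    + intros a b Hab. destruct (RInt_exp_le (exp 1) a b He Hab) as [E1 E2].
      apply Rle_trans with (RInt (fun x => Cmod z * exp (- (x / exp 1))) a b).
      * apply RInt_le; [lra| | |].
        -- apply (ex_RInt_continuous (V := R_CompleteNormedModule)).
           rewrite Rmin_left, Rmax_right by lra. intros x Hx.
           apply (continuous_comp (integrand z) Cmod).
           ++ apply continuous_integrand. lra.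
           ++ apply continuous_Cmod.
        -- apply (ex_RInt_scal (V := R_NormedModule)). exact E1.
        -- intros x Hx. apply integrand_bound; lra.
      * rewrite (RInt_scal (V := R_CompleteNormedModule)) by exact E1.
        apply Rmult_le_compat_l; assumption.
  - intros P HP. apply locally_Cmod in HP. destruct HP as [eta [Heta HP]].
    set (del := eta / (2 * (Cmod z + 1))).
    assert (Hdel : 0 < del) by (apply Rdiv_lt_0_compat; lra).
    set (M := exp 1 * exp 1 / del).
    assert (HM : 0 < M) by (apply Rdiv_lt_0_compat; nra).
    apply (Filter_prod _ _ _ (fun x => 0 < x < Rmin 1 del) (fun y => Rmax 1 M < y)).
    + assert (Hmin : 0 < Rmin 1 del) by (apply Rmin_glb_lt; lra).
      exists (mkposreal _ Hmin). intros x Hx Hx0.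
      change (Rabs (x - 0) < Rmin 1 del) in Hx. rewrite Rminus_0_r in Hx.
      apply Rabs_def2 in Hx. lra.
    + exists (Rmax 1 M). trivial.
    + intros a b Ha Hb. simpl.
      assert (A1 := Rmin_l 1 del). assert (A2 := Rmin_r 1 del).
      assert (B1 := Rmax_l 1 M). assert (B2 := Rmax_r 1 M).
      exists (CInt (integrand z) a b). split.
      * apply CInt_correct, ex_CInt_integrand. lra.
      * apply HP. eapply Rle_lt_trans; [apply truncated_error; trivial; lra|].
        assert (T : exp 1 * exp (- (b / exp 1)) < del).
        { apply Rle_lt_trans with (exp 1 * (exp 1 / b)).
          - apply Rmult_le_compat_l; [lra|].
            replace (exp 1 / b) with (/ (b / exp 1)) by (field; lra).
            apply exp_opp_le_inv, Rdiv_lt_0_compat; lra.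
          - replace (exp 1 * (exp 1 / b)) with (M * del / b) by (unfold M; field; lra).
            apply (Rmult_lt_reg_r b); [lra|]. unfold Rdiv.
            rewrite Rmult_assoc, Rinv_l, Rmult_1_r by lra.
            rewrite (Rmult_comm del). apply Rmult_lt_compat_r; lra. }
        replace eta with ((Cmod z + 1) * (del + del)) by (unfold del; field; lra).
        nra.
Qed.
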